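(* Let $F\colon C_+\to C_+$, $F_i(x)=x_if_i(x)$, where $f\colon C_+\to C_+$ is continuous, $f(x)\gg0$ for all $x\in C_+$, and $f_i(\mathbf e_i)=1$ for all $i$. Let $\varkappa>0$, $\Lambda=[0,(1+\varkappa)\mathbf e]$, and assume that $F{\restriction}_\Lambda\colon\Lambda\to F(\Lambda)$ is a local homeomorphism and that $F$ is weakly retrotone in $\Lambda$. Assume moreover that at least one of the following holds: (α) for any $x,y\in C_+$ with $x<y$: $f_i(x)\ge f_i(y)$ for all $i$, and $f_i(x)>f_i(y)$ for those $i$ with $x_i<y_i$; (β) for any $x,y\in\Lambda$ with $F(x)<F(y)$: $f_i(x)\ge f_i(y)$ for all $i$, and for those $i$ with $F_i(x)<F_i(y)$ either $x_i=0$ or $f_i(x)>f_i(y)$. With $R_n$, $R^n$, $R_*$, $S_*$ as constructed in the context, the following hold. (a) The functions $R_n\colon\Delta\to(0,\infty)$ converge uniformly, as $n\to\infty$, to $R_*$. (b) The functions $R^n\colon\Delta\to(0,\infty)$ converge uniformly, as $n\to\infty$, to $R_*$. (c) $S_*\in\widehat{\mathcal U}$. If additionally $F$ is retrotone in $\Lambda$, or $f_i(x)>f_i(y)$ for all $i$ whenever $x,y\in C_+$ and $x<y$, then $S_*\in\mathcal U$. (d) $S_*$ is invariant under $F$, that is, $F(S_* )=S_*$.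
   Context: Notation: $C_+=\{x\in\mathbb R^d:x_i\ge0\ \forall i\}$; $\mathbf e_i$ standard basis vectors, $\mathbf e=\sum_i\mathbf e_i$; $x\le y$ coordinatewise, $x<y$ if $x\le y$ and $x\ne y$, $x\ll y$ if $x_i<y_i$ for all $i$; $[x,y]=\{z\in C_+:x\le z\le y\}$. $(C_I)_+=\{x\in C_+:x_j=0\ \forall j\notin I\}$; for $x,y\in(C_I)_+$, $x\ll_Iy$ means $x_i<y_i$ for all $i\in I$. $\Delta=\{x\in C_+:\sum_ix_i=1\}$. ''Local homeomorphism'' onto $F(\Lambda)$: each $x\in\Lambda$ has a relatively open neighbourhood $U$ in $\Lambda$ mapped homeomorphically by $F$ onto a relatively open neighbourhood of $F(x)$ in $F(\Lambda)$. $F$ is retrotone in $B$ if for all $x,y\in B$ with $F(x)<F(y)$ one has $x_i<y_i$ whenever $y_i>0$. $F$ is weakly retrotone in $B$ if for all $I\subset\{1,\dots,d\}$ and $x,y\in B$: $F(x)<F(y)$ and $F_i(x)<F_i(y)$ for all $i\in I$ imply $x<y$ and $x_i<y_i$ for all $i\in I$. A set $B\subset C_+$ is unordered if no two distinct points of $B$ are related by $<$; weakly unordered if for any nonempty $I\subset\{1,\dots,d\}$ no two distinct points of $B\cap(C_I)_+$ are related by $\ll_I$. $\widehat{\mathcal U}$ [resp. $\mathcal U$] is the family of weakly unordered [resp. unordered] sets $S\subset\Lambda\setminus\{0\}$ that are mapped homeomorphically onto $\Delta$ by the radial projection $x\mapsto x/\|x\|_1$. The radial representation of such $S$ is the continuous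 function $R\colon\Delta\to(0,\infty)$ with $S=\{R(u)u:u\in\Delta\}$. Construction. Under the hypotheses $F(\Lambda)\subset\Lambda$ and $f_i(0)>1$ for all $i$. Choose $\varepsilon\in(0,1)$ so small that $\min_if_i(x)>1$ for all $x\in C_+$ with $\sum_ix_i\le\varepsilon$. Put $S_0:=\varepsilon\Delta$, $S_n:=F^n(S_0)$, and $S^0:=\{x\in\Lambda:x_k=1+\varkappa\text{ for some }k\}$, $S^n:=F^n(S^0)$; all of these belong to $\widehat{\mathcal U}$. Let $R_n$, $R^n$ be the radial representations of $S_n$, $S^n$. For each $u\in\Delta$ the sequence $(R_n(u))_n$ is strictly increasing; $R_*(u)\in(0,\infty)$ denotes its limit, and $S_*:=\{R_*(u)u:u\in\Delta\}$. *)

(* Defs.v *)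
From HB Require Import structures.
From mathcomp Require Import all_boot all_order all_algebra.
From mathcomp Require Import all_classical all_reals all_analysis.

Set Implicit Arguments.
Unset Strict Implicit.
Unset Printing Implicit Defensive.

Import Order.TTheory GRing.Theory Num.Theory.
Import numFieldNormedType.Exports.

Local Open Scope classical_set_scope.
Local Open Scope ring_scope.

Section Topology.
Context {T U : topologicalType}.

Definition homeo_onto (A : set T) (B : set U) (h : T -> U) : Prop :=
  [/\ {within A, continuous h}, set_bij A B h &
      exists g : U -> T,
        {within B, continuous g} /\ (forall x, A x -> g (h x) = x)].

Definition rel_open (A V : set T) : Prop :=
  exists O : set T, open O /\ V = A `&` O.

End Topology.

Definition local_homeo {T U : topologicalType} (A : set T) (h : T -> U) :=
  forall x, A x ->
    exists (V : set T) (W : set U),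
      [/\ rel_open A V, V x, rel_open (h @` A) W, W (h x) &
          homeo_onto V W h].

Section Euclidean.
Context {R : realType} {d : nat}.
Implicit Types (x y : 'rV[R]_d) (I : {set 'I_d}) (A B S : set 'rV[R]_d).

Definition lev x y : Prop := forall i, x 0 i <= y 0 i.
Definition ltv x y : Prop := lev x y /\ x <> y.
Definition lltv x y : Prop := forall i, x 0 i < y 0 i.
Definition lltv_on I x y : Prop := forall i, i \in I -> x 0 i < y 0 i.

Definition unitv (i : 'I_d) : 'rV[R]_d := delta_mx 0 i.
Definition onesv : 'rV[R]_d := \sum_(i < d) unitv i.

Definition Cplus : set 'rV[R]_d := [set x | forall i, 0 <= x 0 i].
Definition Cface I : set 'rV[R]_d :=
  [set x | Cplus x /\ forall j, j \notin I -> x 0 j = 0].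
Definition order_itv x y : set 'rV[R]_d :=
  [set z | [/\ Cplus z, lev x z & lev z y]].

Definition simplex : set 'rV[R]_d :=
  [set x | Cplus x /\ \sum_(i < d) x 0 i = 1].

Definition norm1 x : R := \sum_(i < d) `|x 0 i|.
Definition radial_proj x : 'rV[R]_d := (norm1 x)^-1 *: x.

Definition retrotone (F : 'rV[R]_d -> 'rV[R]_d) B : Prop :=
  forall x y, B x -> B y -> ltv (F x) (F y) ->
    forall i, 0 < y 0 i -> x 0 i < y 0 i.

Definition weakly_retrotone (F : 'rV[R]_d -> 'rV[R]_d) B : Prop :=
  forall I x y, B x -> B y ->
    ltv (F x) (F y) -> lltv_on I (F x) (F y) -> ltv x y /\ lltv_on I x y.

Definition unordered B : Prop :=
  forall x y, B x -> B y -> x <> y -> ~ ltv x y.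

Definition weakly_unordered B : Prop :=
  forall I, I != finset.set0 -> forall x y,
    (B `&` Cface I) x -> (B `&` Cface I) y -> x <> y -> ~ lltv_on I x y.

Definition Lambda (kappa : R) : set 'rV[R]_d :=
  order_itv 0 ((1 + kappa) *: onesv).

Definition radial_graph_in (kappa : R) S : Prop :=
  S `<=` Lambda kappa `\ 0 /\ homeo_onto S simplex radial_proj.

(* [Uhat] is the family written \widehat{\mathcal U}, [Ufam] is \mathcal U. *)
Definition Uhat (kappa : R) : set (set 'rV[R]_d) :=
  [set S | radial_graph_in kappa S /\ weakly_unordered S].
Definition Ufam (kappa : R) : set (set 'rV[R]_d) :=
  [set S | radial_graph_in kappa S /\ unordered S].

Definition radial_set (r : 'rV[R]_d -> R) : set 'rV[R]_d :=
  [set r u *: u | u in simplex].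

Definition is_radial_rep S (r : 'rV[R]_d -> R) : Prop :=
  [/\ {within simplex, continuous r},
      (forall u, simplex u -> 0 < r u) & S = radial_set r].

(* Only the values on [simplex] are meaningful; there they are determined by S
   as soon as a radial representation exists (otherwise the constant 0 is
   returned). *)
Definition radial_rep S : 'rV[R]_d -> R := xget (cst 0) (is_radial_rep S).

(* F_i(x) = x_i f_i(x) *)
Definition kolmogorov (f : 'rV[R]_d -> 'rV[R]_d) x : 'rV[R]_d :=
  \row_i (x 0 i * f x 0 i).

Definition S_lower f (eps : R) (n : nat) : set 'rV[R]_d :=
  iter n (kolmogorov f) @` [set eps *: u | u in simplex].

Definition S_upper f (kappa : R) (n : nat) : set 'rV[R]_d :=
  iter n (kolmogorov f) @`
    [set x | Lambda kappa x /\ exists k, x 0 k = 1 + kappa].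

Definition R_lower f (eps : R) (n : nat) : 'rV[R]_d -> R :=
  radial_rep (S_lower f eps n).
Definition R_upper f (kappa : R) (n : nat) : 'rV[R]_d -> R :=
  radial_rep (S_upper f kappa n).

Definition R_star f (eps : R) (u : 'rV[R]_d) : R :=
  lim (R_lower f eps n u @[n --> \oo]).
Definition S_star f (eps : R) : set 'rV[R]_d := radial_set (R_star f eps).

Definition condition_alpha (f : 'rV[R]_d -> 'rV[R]_d) : Prop :=
  forall x y, Cplus x -> Cplus y -> ltv x y ->
    (forall i, f x 0 i >= f y 0 i) /\
    (forall i, x 0 i < y 0 i -> f x 0 i > f y 0 i).

Definition condition_beta (kappa : R) (f : 'rV[R]_d -> 'rV[R]_d) : Prop :=
  let F := kolmogorov f in
  forall x y, Lambda kappa x -> Lambda kappa y -> ltv (F x) (F y) ->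
    (forall i, f x 0 i >= f y 0 i) /\
    (forall i, F x 0 i < F y 0 i -> x 0 i = 0 \/ f x 0 i > f y 0 i).

End Euclidean.

(* Main.v *)
Require Import Defs.
From mathcomp Require Import all_boot zify.

(** Let [F] be the map [kolmogorov f]. Points are compared along faces:
    [face_lt x y] says that [x] is strictly below [y] on the support of [y] and
    that both vanish off that support. A set without two points in this relation
    is weakly unordered, and weak retrotonicity implies that [F] reflects
    the relation ([kolmogorov_face_lt]). The proof rests on three consequences.

    Graphs go to graphs. Let [S] be a radial graph without [face_lt] pairs. Its
    image has no such pairs either, so it meets every ray at most once. It meets
    every ray at least once, because the direction of [F (r u *: u)] is a
    continuous function of [u] that maps every face of the simplex to itself,
    and such maps are onto ([face_preserving_onto]). That fact has the strength
    of Brouwer's fixed point theorem; it is derived here from Scarf's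
    combinatorial lemma ([scarf]), applied to the points of a fine grid. So [F]
    acts on these graphs ([Ugraph_kolmogorov]) and preserves their order
    ([radial_rep_kolmogorov_le]).

    The lower sequence. The functions [R_lower f eps n] increase with [n]. Their
    limit is lower semicontinuous as a supremum of continuous functions. Its
    graph inherits the absence of [face_lt] pairs, and this alone makes the limit
    upper semicontinuous ([no_face_lt_usc]); the argument of Dini's theorem then
    gives uniform convergence. If the image of a point of [S_star f eps] were
    strictly above or below [S_star f eps], some lower graph would contain a point
    strictly above a point of [S_star f eps], although that graph is below
    [S_star f eps]; so [S_star f eps] is invariant. To see that it is unordered
    under the stronger assumptions, write two ordered points of it as images of
    points of it: these are related by [face_lt].

    The upper sequence. Condition (alpha) implies (beta) by weak retrotonicity.
    Measure a point by its gauge, the factor by which [S_star f eps] has to be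
    stretched to reach it. Under (beta) the gauge drops strictly under [F] as
    long as the image stays above [S_star f eps] ([gauge_lt]), and by compactness
    it drops by a fixed amount as long as the image has gauge at least
    [1 + delta]. So after finitely many steps the whole upper graph has gauge at
    most [1 + delta], while it stays above [S_star f eps] since [F] preserves the
    order of graphs. *)

Set Implicit Arguments.
Unset Strict Implicit.
Unset Printing Implicit Defensive.

(** * Scarf's lemma *)

Section Cells.
Variables (X I : finType) (r : I -> X -> nat) (c : X -> I) (i0 : I) (x0 : X).
Hypothesis r_inj : forall i, injective (r i).
Hypothesis I_gt1 : 1 < #|I|.

(** No point is strictly above the minima of [A] in all directions at once: a
    combinatorial stand-in for the vertices of an empty simplex whose facets are
    level sets of the ranks. *)
Definition dominant (A : {set X}) :=
  [forall y, exists i, [forall x in A, r i y <= r i x]].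

Definition room (A : {set X}) := dominant A && (#|A| == #|I|).

(** Only facets that carry every colour but [i0] are doors, so that a room with
    a missing colour has an even number of them. *)
Definition door (B : {set X}) :=
  [&& dominant B, c @: B == [set~ i0] & #|B|.+1 == #|I|].

Lemma dominantP (A : {set X}) :
  reflect (forall y, exists i, forall x, x \in A -> r i y <= r i x)
          (dominant A).
Proof.
apply: (iffP forallP) => H y; have := H y.
  by case/existsP => i /forall_inP; exists i.
by case=> i Hi; apply/existsP; exists i; apply/forall_inP.
Qed.

Lemma dominantS (A B : {set X}) : B \subset A -> dominant A -> dominant B.
Proof.
move=> /subsetP sBA /dominantP dA; apply/dominantP => y.
by have [i Hi] := dA y; exists i => x /sBA; exact: Hi.
Qed.

(** The value [x0] is only returned for the empty set. *)
Definition bot (A : {set X}) (i : I) : X :=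
  [arg min_(x < odflt x0 [pick x in A] in A) r i x].

Lemma botP (A : {set X}) i : A != set0 ->
  bot A i \in A /\ forall x, x \in A -> r i (bot A i) <= r i x.
Proof.
move=> A0; rewrite /bot; case: arg_minnP => //.
by case: pickP => //= A1; case/set0Pn: A0 => x; rewrite A1.
Qed.

Lemma bot_eq (A : {set X}) i m :
  m \in A -> (forall x, x \in A -> r i m <= r i x) -> bot A i = m.
Proof.
move=> mA Hm; have A0 : A != set0 by apply/set0Pn; exists m.
have [bA Hb] := botP i A0.
by apply: (@r_inj i); apply/eqP; rewrite eqn_leq Hb // Hm.
Qed.

(** A point of a dominant set is not strictly above all the minima, so it is the
    minimum in some direction. *)
Lemma bot_onto (A : {set X}) : A != set0 -> dominant A -> bot A @: setT = A.
Proof.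
move=> A0 /dominantP dA; apply/setP => x; apply/imsetP/idP => [[i _ ->]|xA].
  by case: (botP i A0).
by have [i Hi] := dA x; exists i; rewrite // (bot_eq xA Hi).
Qed.

(** The candidates for the vertex that takes over as minimum in direction [k]. *)
Definition above (B : {set X}) (k : I) : {set X} :=
  [set y | [forall (l | l != k), r l (bot B l) < r l y]].

Lemma aboveP (B : {set X}) k y :
  reflect (forall l, l != k -> r l (bot B l) < r l y) (y \in above B k).
Proof. by rewrite inE; exact: forall_inP. Qed.

Definition top (k : I) (A : {set X}) : X :=
  [arg max_(x > odflt x0 [pick x in A] in A) r k x].

Lemma topP (A : {set X}) i : A != set0 ->
  top i A \in A /\ forall x, x \in A -> r i x <= r i (top i A).
Proof.
move=> A0; rewrite /top; case: arg_maxnP => //.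
by case: pickP => //= A1; case/set0Pn: A0 => x; rewrite A1.
Qed.

Lemma room_superset (A B : {set X}) : #|B|.+1 = #|I| -> B \subset A -> room A ->
  exists2 x, x \notin B & A = x |: B.
Proof.
move=> cB sBA /andP[_ /eqP cA].
have /cards1P[x Ex] : #|A :\: B| == 1.
  by rewrite cardsD (setIidPr sBA) cA -cB subSn ?subnn.
have : x \in A :\: B by rewrite Ex set11.
rewrite inE => /andP[xB _]; exists x => //.
by rewrite -(setID A B) (setIidPr sBA) Ex setUC.
Qed.

(** A door has one vertex less than there are directions, so two directions [i]
    and [j] share their minimum. The vertex that a room adds to the door must
    become the minimum in direction [i] or [j]; in direction [k] it must be the
    highest candidate of [above B k], since otherwise that candidate would
    contradict dominance. *)
Lemma door_rooms (B : {set X}) : door B ->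
  exists i j, [/\ i != j, bot B i = bot B j &
    #|[set A | room A & B \subset A]|
      = (above B i != set0) + (above B j != set0)].
Proof.
move=> /and3P[dB _ /eqP cB].
have B0 : B != set0 by rewrite -card_gt0 -ltnS cB.
have botB i := botP i B0.
have ontoB := bot_onto B0 dB.
have /injectivePn[i [j nij eij]] : ~~ injectiveb (bot B).
  apply/negP => /injectiveP inj; have := card_imset setT inj.
  by rewrite ontoB cardsT -cB => /eqP; rewrite (ltn_eqF (ltnSn _)).
exists i, j; split=> //.
have kP k y : k \in [set i; j] -> y \in B -> exists2 l, l != k & bot B l = y.
  move=> kij; rewrite -{1}ontoB => /imsetP[l _ ->].
  have [->|] := eqVneq l k; last by exists l.
  move: kij; rewrite !inE => /orP[] /eqP ->; last by exists i.
  by exists j; rewrite // eq_sym.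
pose K := [set k in [set i; j] | above B k != set0].
pose rm k := top k (above B k) |: B.
have tP k : k \in K -> [/\ top k (above B k) \notin B & room (rm k)].
  rewrite inE => /andP[kij Mk].
  have [/aboveP tM tmax] := topP k Mk.
  have tB : top k (above B k) \notin B.
    by apply/negP => /(kP _ _ kij)[l lk El]; have := tM _ lk; rewrite El ltnn.
  split=> //; rewrite /room cardsU1 tB add1n cB eqxx andbT.
  apply/dominantP => y; have [l Hl] := dominantP _ dB y.
  have [yM|/aboveP yM] := boolP (y \in above B k).
    have El : l = k.
      apply/eqP/negPn/negP => lk; have /aboveP/(_ _ lk) := yM.
      by rewrite ltnNge Hl //; case: (botB l).
    exists k => x; rewrite !inE => /orP[/eqP->|]; first exact: tmax.
    by rewrite -El; exact: Hl.
  have [l' lk Hl'] : exists2 l', l' != k & r l' y <= r l' (bot B l').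
    have : ~~ [forall (l | l != k), r l (bot B l) < r l y].
      by apply/negP => /forall_inP.
    by rewrite negb_forall_in => /exists_inP[l' ? ?]; exists l'; rewrite // leqNgt.
  exists l' => x; rewrite !inE => /orP[/eqP->|xB].
    exact: leq_trans Hl' (ltnW (tM _ lk)).
  by apply: leq_trans Hl' _; case: (botB l') => _; apply.
have rm_inj : {in K &, injective rm}.
  move=> k k' kK k'K E; apply/eqP/negPn/negP => nkk'.
  have [tB _] := tP _ kK; have [tB' _] := tP _ k'K.
  have Et : top k (above B k) = top k' (above B k').
    have : top k (above B k) \in rm k' by rewrite -E setU11.
    by rewrite !inE (negPf tB) orbF => /eqP.
  move: kK k'K; rewrite !inE => /andP[_ Mk] /andP[_ Mk'].
  have [/aboveP tM _] := topP k Mk; have [/aboveP tM' _] := topP k' Mk'.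
  have [l Hl] := dominantP _ dB (top k (above B k)).
  have [bl _] := botB l; have := Hl _ bl; rewrite leqNgt.
  have [El|lk] := eqVneq l k; last by rewrite tM.
  by rewrite Et tM' // El.
have -> : [set A | room A & B \subset A] = rm @: K.
  apply/setP => A; rewrite inE; apply/andP/imsetP => [[rA sBA]|[k kK ->]]; last first.
    by have [? ?] := tP _ kK; split=> //; exact: subsetUr.
  have [x xB EA] := room_superset cB sBA rA.
  have /andP[dA /eqP cA] := rA.
  have A0 : A != set0 by rewrite EA; apply/set0Pn; exists x; rewrite setU11.
  have ontoA := bot_onto A0 dA.
  have injA : injective (bot A).
    have /imset_injP inj : #|bot A @: setT| == #|[set: I]|.
      by rewrite ontoA cA cardsT.
    by move=> ? ? /inj; apply.
  have /imsetP[k _ Ek] : x \in bot A @: setT by rewrite ontoA EA setU11.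
  have botAB l : l != k -> bot A l = bot B l.
    move=> lk; have [bA bAmin] := botP l A0.
    apply/esym/bot_eq => [|y yB]; last by apply: bAmin; rewrite EA inE yB orbT.
    move: bA; rewrite {2}EA !inE Ek => /orP[/eqP /injA|//].
    by move=> lk'; rewrite lk' eqxx in lk.
  have kij : k \in [set i; j].
    rewrite !inE; apply/negPn/negP; rewrite negb_or => /andP[ki kj].
    have : i = j by apply: injA; rewrite !botAB ?[_ == k]eq_sym.
    by move/eqP; rewrite (negPf nij).
  have xM : x \in above B k.
    apply/aboveP => l lk; rewrite -botAB // ltn_neqAle; apply/andP; split.
      apply/eqP => /r_inj E; move: lk; rewrite Ek in E.
      by rewrite (injA _ _ E) eqxx.
    by case: (botP l A0) => _; apply; rewrite EA setU11.
  have Mk : above B k != set0 by apply/set0Pn; exists x.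
  exists k; first by rewrite inE kij.
  rewrite EA /rm; congr (_ |: _).
  have [tM tmax] := topP k Mk.
  apply: (@r_inj k); apply/eqP; rewrite eqn_leq tmax //=.
  have [l Hl] := dominantP _ dA (top k (above B k)).
  have [El|lk] := eqVneq l k; first by rewrite El in Hl; rewrite Hl // EA setU11.
  have /aboveP/(_ _ lk) := tM; rewrite ltnNge Hl // EA !inE.
  by case: (botB l) => ->; rewrite orbT.
rewrite card_in_imset //.
rewrite -(cardsID [set i]).
have -> : K :&: [set i] = if above B i != set0 then [set i] else set0.
  apply/setP => k; rewrite !inE; have [->|ki] := eqVneq k i.
    by rewrite /= andbT; case: ifP; rewrite !inE ?eqxx.
  by rewrite andbF; case: ifP; rewrite !inE // (negPf ki).
have -> : K :\: [set i] = if above B j != set0 then [set j] else set0.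
  apply/setP => k; rewrite !inE; have [->|kj] := eqVneq k j.
    by rewrite eq_sym nij orbT /=; case: ifP; rewrite !inE ?eqxx.
  by rewrite orbF; have [_|_] /= := eqVneq k i; case: ifP; rewrite !inE ?(negPf kj).
by case: (above B i == _); case: (above B j == _); rewrite /= ?cards1 ?cards0.
Qed.

(** When [A] has a door but lacks the colour [i0], exactly one colour occurs
    twice in [A]; removing either vertex of that colour leaves a door. *)
Lemma room_doors_even (A : {set X}) : room A -> c @: A != setT ->
  ~~ odd #|[set B | door B & B \subset A]|.
Proof.
move=> rA ncA; have /andP[dA _] := rA.
set D := [set B | _ & _].
have [->|/set0Pn[B]] := eqVneq D set0; first by rewrite cards0.
rewrite inE => /andP[/and3P[dB /eqP cB /eqP sB] sBA].
have [x xB EA] := room_superset sB sBA rA.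
have injB : {in B &, injective c}.
  by apply/imset_injP; rewrite cB cardsC1 -sB.
have cx : c x \in c @: B.
  rewrite cB !inE; apply: contraNneq ncA => cx0.
  by rewrite EA imsetU1 cB cx0 setUC; apply/eqP/setP => k; rewrite !inE orNb.
have /imsetP[x' x'B cxx'] := cx.
have cA : c @: A = [set~ i0] by rewrite EA imsetU1 (setUidPr _) // sub1set.
have xx' : x != x' by apply: contraNneq xB => ->.
have DE : D = [set A :\ x; A :\ x'].
  apply/setP => B'; rewrite !inE; apply/andP/orP => [[/and3P[dB' /eqP cB' /eqP sB'] sBA']|].
    have [x2 x2B' EA'] := room_superset sB' sBA' rA.
    have B'E : B' = A :\ x2 by rewrite EA' setU1K.
    have /imsetP[z zB' Ez] : c x2 \in c @: B' by rewrite cB' -cA imset_f // EA' setU11.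
    have zA : z \in A by rewrite EA' inE zB' orbT.
    have x2A : x2 \in A by rewrite EA' setU11.
    rewrite B'E; have [->|x2x] := eqVneq x2 x; first by left.
    right; suff -> : x2 = x' by [].
    have x2B : x2 \in B by move: x2A; rewrite EA !inE (negPf x2x).
    apply: (injB) => //; rewrite -cxx' Ez.
    move: zA; rewrite EA !inE => /orP[/eqP-> //|zB].
    by move: x2B'; rewrite (injB _ _ x2B zB Ez) zB'.
  have main y : y \in A -> c @: (A :\ y) = [set~ i0] -> door (A :\ y) && (A :\ y \subset A).
    move=> yA cy; rewrite subD1set andbT /door cy eqxx (dominantS _ dA) ?subD1set //=.
    by have := cardsD1 y A; rewrite yA add1n => <-; case/andP: rA.
  have xA : x \in A by rewrite EA setU11.
  have x'A : x' \in A by rewrite EA inE x'B orbT.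
  case=> /eqP ->; apply/andP; apply: main => //.
    by rewrite EA setU1K.
  apply/setP => k; rewrite -cA; apply/imsetP/imsetP => [[y]|[y yA ->]].
    by rewrite !inE => /andP[_ yA] ->; exists y.
  have [->|yx'] := eqVneq y x'; first by exists x; rewrite // !inE xx' xA.
  by exists y; rewrite // !inE yx' yA.
rewrite DE cards2; suff -> : A :\ x != A :\ x' by [].
apply: contraNneq xx' => E; have : x \notin A :\ x' by rewrite -E !inE eqxx.
by rewrite !inE EA setU11 andbT negbK.
Qed.

(** Count the incident pairs of doors and rooms modulo 2 in two ways. *)
Lemma colorful_room_of_odd :
  odd (\sum_(B | door B) #|[set A | room A & B \subset A]|) ->
  exists2 A, room A & c @: A = setT.
Proof.
move=> odd_sum.
suff /exists_inP[A rA /eqP cA] : [exists (A | room A), c @: A == setT] by exists A.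
apply: contraLR odd_sum.
rewrite negb_exists_in => /forall_inP no.
under eq_bigr => B _ do rewrite -sum1dep_card big_mkcondr.
rewrite exchange_big /=.
apply: (big_ind (fun n => ~~ odd n)) => // [m n|A rA].
  by rewrite oddD => /negPf -> /negPf ->.
rewrite -big_mkcondr sum1dep_card; apply: room_doors_even => //.
by apply/eqP => cA; have := no _ rA; rewrite cA eqxx.
Qed.

End Cells.

Section Slack.
Variables (T I : finType) (r : I -> T -> nat) (c : T -> I) (t0 : T).
Hypothesis r_inj : forall i, injective (r i).
Hypothesis I_gt1 : 1 < #|I|.

Let M := \max_(p : I * T) (r p.1 p.2).+1.

(** One slack vertex [inr j] is added for each direction: in direction [j] it is
    below all other points, in the other directions it is above all of [T]. The
    slacks close off the boundary, so that exactly one door has a single room. *)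
Definition slack_rank (i : I) (x : T + I) : nat :=
  match x with
  | inl t => (r i t).+1
  | inr j => if j == i then 0 else M.+1 + enum_rank j
  end.

Definition slack_color (x : T + I) : I :=
  match x with inl t => c t | inr j => j end.

Lemma slack_rank_max i t : r i t < M.
Proof. exact: (leq_bigmax (i, t) : (r i t).+1 <= _). Qed.

Lemma slack_rank_inj i : injective (slack_rank i).
Proof.
move=> [t|j] [t'|j'] /=.
- by case=> /r_inj ->.
- case: eqP => // _ [E]; have := slack_rank_max i t.
  by rewrite ltnNge E leq_addr.
- case: eqP => // _ [E]; have := slack_rank_max i t'.
  by rewrite ltnNge -E leq_addr.
- case: eqP => [->|_]; case: eqP => [->|_] //.
  by case=> /addnI /ord_inj /enum_rank_inj ->.
Qed.

Let dom := dominant slack_rank.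
Let slacks (k : I) : {set T + I} := [set inr j | j in [set~ k]].

Lemma mem_slacks k x : (x \in slacks k) = if x is inr j then j != k else false.
Proof.
case: x => [t|j]; first by apply/imsetP => -[].
by rewrite mem_imset ?inE // => ? ? [].
Qed.

Lemma card_slacks k : #|slacks k|.+1 = #|I|.
Proof.
rewrite card_imset; last by move=> ? ? [].
by rewrite cardsC1 prednK // (ltn_trans _ I_gt1).
Qed.

(** In direction [l], only slacks lie above a slack [inr j] with [j != l]. *)
Lemma slack_min (B : {set T + I}) (x0 : T + I) l j : B != set0 ->
  #|B|.+1 = #|I| -> bot slack_rank x0 B l = inr j -> j != l -> B = slacks l.
Proof.
move=> B0 cB Eb jl; have [_ bmin] := botP slack_rank x0 l B0.
apply/eqP; rewrite eqEcard -ltnS cB card_slacks leqnn andbT.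
apply/subsetP => -[t|k] xB; rewrite mem_slacks.
  have := bmin _ xB; rewrite Eb /= (negPf jl) ltnNge.
  by rewrite (leq_trans (slack_rank_max l t)) ?leq_addr.
apply/eqP => kl; have := bmin _ xB.
by rewrite Eb /= kl eqxx (negPf jl).
Qed.

Lemma slack_bot (B : {set T + I}) x0 k : inr k \in B ->
  bot slack_rank x0 B k = inr k.
Proof.
move=> kB; apply: bot_eq => [||x _] //=; last by rewrite eqxx.
exact: slack_rank_inj.
Qed.

(** Of the two directions sharing their minimum, [k] runs out of candidates only
    if [inr k] is itself a vertex of the door. Then [inr k] is the shared
    minimum, and the door consists of all slacks but one. *)
Lemma slack_door_rooms i0 (B : {set T + I}) :
  door slack_rank slack_color i0 B ->
  odd #|[set A | room slack_rank A & B \subset A]| = (B == slacks i0).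
Proof.
move=> dB; have /and3P[domB /eqP colB /eqP cB] := dB.
have [i [j [nij eij ->]]] := door_rooms (inl t0) slack_rank_inj I_gt1 dB.
set b := bot _ _ _ in eij *.
have B0 : B != set0 by rewrite -card_gt0 -ltnS cB.
(* the slack of direction k is a candidate unless it is already a vertex *)
have notin k : inr k \notin B -> above slack_rank (inl t0) B k != set0.
  move=> kB; apply/set0Pn; exists (inr k); apply/aboveP => l lk.
  have [bB _] := botP slack_rank (inl t0) l B0; rewrite -/b in bB *.
  case Eb: (b l) bB => [t|m] bB /=.
    by rewrite eq_sym (negPf lk) ltnS (leq_trans (slack_rank_max l t)) ?leq_addr.
  have [Em|ml] := eqVneq m l; first by rewrite eq_sym (negPf lk).
  have EB := slack_min B0 cB Eb ml.
  by move: kB; rewrite EB mem_slacks negbK eq_sym (negPf lk).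
have isin k k' : k != k' -> b k = b k' -> inr k \in B ->
    B = slacks k' /\ above slack_rank (inl t0) B k = set0.
  move=> kk' Ebk kB.
  have Ek : b k = inr k by apply: slack_bot.
  have EB : B = slacks k' by apply: (slack_min B0 cB (x0 := inl t0) (j := k)); rewrite -?Ek.
  split=> //; apply/setP => y; rewrite [RHS]inE; apply/aboveP => Hy.
  have k'k : k' != k by rewrite eq_sym.
  have := Hy _ k'k; rewrite -/b -Ebk Ek /= (negPf kk').
  case: y Hy => [t|m] Hy /=.
    by rewrite ltnS ltnNge (leq_trans (ltnW (slack_rank_max k' t))) ?leq_addr.
  have [Em|mk'] := eqVneq m k'; first by rewrite ltn0.
  have [->|mk] := eqVneq m k; first by rewrite ltnn.
  have := Hy _ mk; rewrite -/b.
  have -> : b m = inr m by apply: slack_bot; rewrite EB mem_slacks.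
  by rewrite /= eqxx ltnn.
have slE k : (B == slacks k) = (inr k \notin B) && [forall (l | l != k), inr l \in B].
  apply/eqP/andP => [->|[kB /forall_inP lB]].
    by rewrite mem_slacks eqxx; split=> //; apply/forall_inP => l; rewrite mem_slacks.
  apply/esym/eqP; rewrite eqEcard -ltnS card_slacks cB leqnn andbT.
  by apply/subsetP => -[t|l]; rewrite mem_slacks // => /lB.
have slack_i0 k : B = slacks k -> k = i0.
  move=> EB; apply/eqP; have : k \notin slack_color @: B.
    rewrite EB; apply/negP => /imsetP[[t|l]]; rewrite mem_slacks //= => lk kl.
    by rewrite kl eqxx in lk.
  by rewrite colB !inE negbK.
have nji : j != i by rewrite eq_sym.
have [iB|iB] := boolP (inr i \in B).
  have [EB ->] := isin _ _ nij eij iB.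
  rewrite eqxx /= notin; last by rewrite EB mem_slacks eqxx.
  by rewrite -(slack_i0 _ EB) EB eqxx.
have [jB|jB] := boolP (inr j \in B).
  have [EB ->] := isin _ _ nji (esym eij) jB.
  rewrite eqxx /= notin; last by rewrite EB mem_slacks eqxx.
  by rewrite -(slack_i0 _ EB) EB eqxx.
rewrite !notin //=; apply/esym/eqP => EB.
by move: iB jB nij; rewrite EB !mem_slacks !negbK => /eqP-> /eqP->; rewrite eqxx.
Qed.

(** All doors but the one made of the slacks other than [inr i0] have two rooms,
    so the number of incident pairs is odd and a room of all colours exists. Its
    points in [T] form [A]; the directions whose slack it avoids form [C]. *)
Lemma scarf : exists (A : {set T}) (C : {set I}),
  C \subset c @: A /\
  forall y, exists2 i, i \in C & forall x, x \in A -> r i y <= r i x.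
Proof.
have [i0 _] : exists i0 : I, true.
  have /card_gt0P[i _] : 0 < #|I| by exact: ltn_trans I_gt1.
  by exists i.
have sdoor : door slack_rank slack_color i0 (slacks i0).
  rewrite /door card_slacks eqxx andbT; apply/andP; split.
    apply/dominantP => -[t|k].
      exists i0 => -[t'|j]; rewrite mem_slacks //= => ji0.
      by rewrite (negPf ji0) ltnS (leq_trans (ltnW (slack_rank_max i0 t))) ?leq_addr.
    exists k => x _ /=; by rewrite eqxx.
  by rewrite -imset_comp imset_id.
have [|A rA cA] := @colorful_room_of_odd _ _ slack_rank slack_color i0.
  rewrite (bigD1 (slacks i0)) //= oddD (slack_door_rooms sdoor) eqxx.
  apply: (big_ind (fun n => ~~ odd n)) => // [m n|B /andP[dB nB]].
    by rewrite oddD => /negPf -> /negPf ->.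
  by rewrite (slack_door_rooms dB).
have /andP[/dominantP dA _] := rA.
exists [set t | inl t \in A], [set i | inr i \notin A]; split.
  apply/subsetP => i; rewrite inE => iA.
  have /imsetP[[t|j] xA /= Ei] : i \in slack_color @: A by rewrite cA inE.
    by apply/imsetP; exists t; rewrite ?inE.
  by rewrite Ei xA in iA.
move=> y; have [i Hi] := dA (inl y); exists i.
  by rewrite inE; apply/negP => /Hi; rewrite /= eqxx.
by move=> x; rewrite inE => /Hi.
Qed.

End Slack.

(** * Multicoloured clusters in the grid of a simplex *)

Section Grid.
Variables (d N : nat) (c : ('I_d -> nat) -> 'I_d).
Hypothesis d_gt1 : 1 < d.

Let grid := {p : {ffun 'I_d -> 'I_N.+1} | \sum_i p i == N}.
Let coord (p : grid) (i : 'I_d) : nat := val p i.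
(* ties between equal coordinates are broken by the enumeration of the grid *)
Let rank (i : 'I_d) (p : grid) : nat := coord p i * #|{: grid}| + enum_rank p.

Lemma grid_point (g : 'I_d -> nat) : \sum_i g i = N ->
  exists p : grid, forall i, coord p i = g i.
Proof.
move=> sg; have g_le i : g i < N.+1.
  by rewrite ltnS -sg (bigD1 i) //= leq_addr.
pose p := [ffun i => Ordinal (g_le i)].
have sp : \sum_i p i == N by apply/eqP; rewrite -[RHS]sg; apply: eq_bigr => i _; rewrite ffunE.
by exists (exist _ p sp) => i; rewrite /coord ffunE.
Qed.

Lemma rank_inj i : injective (rank i).
Proof.
move=> p q; rewrite /rank => E; apply/enum_rank_inj/val_inj => /=.
have := congr1 (fun n => n %% #|{: grid}|) E.
by rewrite !modnMDl !modn_small.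
Qed.

Lemma rank_le i p q : rank i p <= rank i q -> coord p i <= coord q i.
Proof.
apply: contraTT; rewrite -!ltnNge /rank => pq.
apply: (@leq_trans ((coord q i).+1 * #|{: grid}|)).
  by rewrite mulSn addnC ltn_add2r ltn_ord.
by rewrite (leq_trans (leq_mul pq (leqnn _))) ?leq_addr.
Qed.

(** Let [m i] be the minimum of coordinate [i] over the set [A] of Scarf's lemma.
    If the sum of [(m i).+1] over [C] were at most [N], some grid point would
    exceed all the minima. So in a point of [A] less than [#|C|], hence less than
    [d], of the total [N] is left beyond the minima: two points of [A] differ by
    less than [d] in each coordinate. A coordinate that is at least [d] has its
    index in [C], and every colour of [C] occurs in [A]. *)
Lemma multicolored_grid_cluster :
  exists p : 'I_d -> nat, \sum_i p i = N /\
    forall i, d <= p i -> exists q : 'I_d -> nat,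
      [/\ \sum_i q i = N, c q = i &
          forall j, q j <= p j + d /\ p j <= q j + d].
Proof.
have i0 : 'I_d := Ordinal (ltn_trans (ltnSn 0) d_gt1).
have [t0 _] : exists t0 : grid, forall i, coord t0 i = (if i == i0 then N else 0).
  by apply: grid_point; rewrite -big_mkcond big_pred1_eq.
have I_gt1 : 1 < #|'I_d| by rewrite card_ord.
have [A [C [/subsetP sCA dA]]] := scarf (fun p : grid => c (coord p)) t0 rank_inj I_gt1.
have [i1 i1C _] := dA t0.
have /imsetP[p0 p0A _] := sCA _ i1C.
pose m i := coord [arg min_(p < p0 in A) coord p i] i.
have mP i p : p \in A -> m i <= coord p i.
  by rewrite /m; case: arg_minnP => // q _; apply.
have m_att i : exists2 p, p \in A & m i = coord p i.
  by rewrite /m; case: arg_minnP => // q qA _; exists q.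
have m_lt : N < \sum_(i in C) m i + #|C|.
  rewrite ltnNge; apply/negP => le_N.
  pose rest := N - (\sum_(i in C) m i + #|C|).
  pose g i := if i \in C then (m i).+1 + (if i == i1 then rest else 0) else 0.
  have [|y Hy] := @grid_point g.
    rewrite -big_mkcond big_split /= -big_mkcondr /=.
    have E : (fun i => (i \in C) && (i == i1)) =1 pred1 i1.
      by move=> i /=; case: eqP => [->|]; rewrite ?i1C ?andbF.
    rewrite [X in _ + X](big_pred1 _ E).
    rewrite -[in X in X + _](eq_bigr _ (fun i _ => addn1 (m i))) big_split /= sum1_card.
    by rewrite subnKC.
  have [i iC Hi] := dA y; have [p pA mp] := m_att i.
  have := rank_le (Hi p pA).
  by rewrite Hy /g iC -mp addSn ltnNge leq_addr.
have sumE p : \sum_i coord p i = N by apply/eqP; exact: (valP p).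
have cl p i : p \in A -> coord p i < (if i \in C then m i else 0) + d.
  move=> pA; have cC : #|C| <= d by rewrite -[leqRHS]card_ord max_card.
  have sC : \sum_(i in C) coord p i + \sum_(i | i \notin C) coord p i = N.
    by rewrite -(sumE p) [RHS](bigID (mem C)).
  have mC : \sum_(i in C) m i <= \sum_(i in C) coord p i.
    by apply: leq_sum => j _; exact: mP.
  case: ifPn => iC.
    have eC (h : 'I_d -> nat) :
        \sum_(j in C) h j = h i + \sum_(j in C | j != i) h j by exact: bigD1.
    have : \sum_(j in C | j != i) m j <= \sum_(j in C | j != i) coord p j.
      by apply: leq_sum => j /andP[_ _]; exact: mP.
    move: m_lt sC; rewrite !eC; lia.
  have : coord p i <= \sum_(i | i \notin C) coord p i.
    by rewrite (bigD1 i iC) /= leq_addr.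
  lia.
have ge p i : p \in A -> (if i \in C then m i else 0) <= coord p i.
  by move=> pA; case: ifP => // _; exact: mP.
exists (coord p0); split=> // i dp.
have iC : i \in C.
  by have := cl _ i p0A; case: ifP => //; rewrite add0n ltnNge dp.
have /imsetP[q qA cq] := sCA _ iC.
exists (coord q); split=> // j.
have := cl _ j p0A; have := cl _ j qA; have := ge _ j p0A; have := ge _ j qA.
lia.
Qed.

End Grid.

From mathcomp Require Import all_order all_algebra lra.
From mathcomp Require Import all_classical all_reals all_analysis.

Import Order.TTheory GRing.Theory Num.Theory.
Import numFieldNormedType.Exports.

Local Open Scope classical_set_scope.
Local Open Scope ring_scope.

(** * Face-preserving maps of the simplex *)

Section Topology.
Context {R : realType} {d : nat}.
Implicit Types (u v w : 'rV[R]_d).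

Lemma within_comp (T U V : topologicalType) (A : set T) (B : set U)
    (h : T -> U) (g : U -> V) :
  {within A, continuous h} -> (forall x, A x -> B (h x)) ->
  {within B, continuous g} -> {within A, continuous (g \o h)}.
Proof.
move=> /subspace_continuousP ch hAB /subspace_continuousP cg.
apply/subspace_continuousP => x Ax.
apply: (@cvg_comp _ _ _ _ _ _ (within B (nbhs (h x)))); last exact/cg/hAB.
move=> W WB.
have {}WB : nbhs (h x) [set z | B z -> W z] := WB.
have := ch x Ax _ WB; rewrite /= !nbhs_simpl /=.
apply: (@filterS _ (nbhs x) _ (fun z => A z -> B (h z) -> W (h z))) => z HW Az.
exact: (HW Az (hAB _ Az)).
Qed.

Lemma within_continuous_rV (T : topologicalType) (A : set T) (h : T -> 'rV[R]_d) :
  (forall i, {within A, continuous (fun x => h x 0 i)}) ->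
  {within A, continuous h}.
Proof.
move=> ch; apply/subspace_continuousP => x Ax; apply/cvg_ballP => e e0.
near=> z; split=> // k i; rewrite (ord1 k) {k}; move: i; near: z.
apply: filter_forall => i.
by move/subspace_continuousP/(_ x Ax)/cvg_ballP/(_ e e0) : (ch i).
Unshelve. all: by end_near. Qed.

Lemma within_continuous_coord (T : topologicalType) (A : set T)
    (h : T -> 'rV[R]_d) i :
  {within A, continuous h} -> {within A, continuous (fun x => h x 0 i)}.
Proof.
apply: (@within_continuous_comp _ _ _ A h (fun y : 'rV[R]_d => y 0 i)).
by move=> y _; exact: coord_continuous.
Qed.

Lemma within_continuous_sum (T : topologicalType) (A : set T) (n : nat)
    (h : 'I_n -> T -> R) :
  (forall i, {within A, continuous (h i)}) ->
  {within A, continuous (fun x => \sum_i h i x)}.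
Proof.
elim: n h => [|n IH] h ch.
  rewrite (_ : (fun _ => _) = cst 0); last by apply/funext => x; rewrite big_ord0.
  by move=> x; exact: cst_continuous.
rewrite (_ : (fun _ => _) = h ord0 + (fun x => \sum_i h (lift ord0 i) x)).
  by apply: within_continuousD => //; exact: IH.
by apply/funext => x; rewrite big_ord_recl.
Qed.

Lemma simplex_le_eq u v : simplex u -> simplex v -> lev u v -> u = v.
Proof.
move=> [_ su] [_ sv] uv; apply/rowP => i; apply/eqP.
have : \sum_i (v 0 i - u 0 i) == 0 by rewrite sumrB su sv subrr.
rewrite psumr_eq0 => [/allP/(_ i)|j _]; last by rewrite subr_ge0.
by rewrite mem_index_enum subr_eq0 eq_sym => /(_ isT).
Qed.

Lemma closed_eq_level (T : topologicalType) (h : T -> R) (a : R) :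
  continuous h -> closed [set x | h x = a].
Proof.
by move=> /continuous_closedP/(_ [set r | r = a]); apply; exact: closed_eq.
Qed.

Lemma continuous_coord_sum : continuous (fun x : 'rV[R]_d => \sum_i x 0 i).
Proof.
have /subspace_continuousP H :
    {within setT, continuous (fun x : 'rV[R]_d => \sum_i x 0 i)}.
  apply: within_continuous_sum => i.
  by apply: continuous_subspaceT; exact: coord_continuous.
by move=> x; have := H x I; rewrite withinET.
Qed.

Lemma compact_box (a b : R) :
  compact [set x : 'rV[R]_d | forall i, a <= x 0 i <= b].
Proof.
have := @rV_compact R d (fun=> `[a, b]%classic) (fun _ => @segment_compact _ _ _).
by congr compact; apply/seteqP; split => x /= H i; have := H i; rewrite in_itv.
Qed.

Lemma compact_simplex : compact (@simplex R d).
Proof.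
rewrite (_ : simplex = [set x : 'rV[R]_d | forall i, 0 <= x 0 i <= 1] `&`
                       [set x | \sum_i x 0 i = 1]).
  apply: compact_closedI; first exact: compact_box.
  exact: closed_eq_level continuous_coord_sum.
apply/seteqP; split => [x [x0 x1]|x [x0 x1]]; split=> //= i.
  by rewrite x0 -x1 (bigD1 i) //= lerDl sumr_ge0 // => j _; exact: x0.
by case/andP: (x0 i).
Qed.

Lemma simplex_gt u v : simplex u -> simplex v -> u <> v ->
  exists i, v 0 i < u 0 i.
Proof.
move=> su sv nuv; apply: contrapT => H; apply: nuv.
apply: simplex_le_eq => // i; rewrite leNgt; apply/negP => vu.
by apply: H; exists i.
Qed.

Lemma within_gt_ball (T : pseudoMetricType R) (A : set T) (h : T -> R) x a :
  {within A, continuous h} -> A x -> a < h x ->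
  exists2 e : R, 0 < e & forall y, A y -> ball x e y -> a < h y.
Proof.
move=> /subspace_continuousP ch Ax ax.
have := ch x Ax _ (lt_nbhsr ax).
move=> /nbhs_ballP[e /= e0 He]; exists e => // y Ay bxy; exact: He.
Qed.

Lemma near_natV_lt (a e : R) : 0 < e -> \forall N \near \oo, a / N%:R < e.
Proof.
move=> e0; near=> N; rewrite ltr_pdivrMr; last first.
  by rewrite ltr0n; near: N; exact: nbhs_infty_gt.
rewrite mulrC -ltr_pdivrMr //; near: N; exact: nbhs_infty_gtr.
Unshelve. all: by end_near. Qed.

(** Suppose that [v] is missed. Then at each [u] some coordinate of [phi] exceeds
    that of [v], and the same coordinate of [u] is positive because faces are
    preserved. By compactness both facts hold with a margin uniform in [u]. Colour
    each point of a grid finer than the margin by a coordinate in which [phi] does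
    not exceed [v]: a multicoloured cluster is a contradiction. *)
Lemma face_preserving_onto (phi : 'rV[R]_d -> 'rV[R]_d) :
  {within simplex, continuous phi} ->
  (forall u, simplex u -> simplex (phi u)) ->
  (forall u i, simplex u -> u 0 i = 0 -> phi u 0 i = 0) ->
  forall v, simplex v -> exists2 u, simplex u & phi u = v.
Proof.
move=> cphi sphi face v sv; apply: contrapT => no.
have {}no u : simplex u -> exists i, v 0 i < phi u 0 i.
  by move=> su; apply: simplex_gt => // [|E]; [exact: sphi|apply: no; exists u].
have d_gt1 : (1 < d)%N.
  case: d phi cphi sphi face v sv no => [|[|n]] // phi cphi sphi face v sv no.
    by case: sv => _ /eqP; rewrite big_ord0 eq_sym oner_eq0.
  have [i] := no _ sv; have [_] := sv; have [_] := sphi _ sv.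
  by rewrite !big_ord1 (ord1 i) => -> ->; rewrite ltxx.
pose good (N : nat) (u : 'rV[R]_d) := exists i, d%:R / N%:R < u 0 i /\
  forall w, simplex w -> (forall j, `|u 0 j - w 0 j| <= d%:R / N%:R) ->
  v 0 i < phi w 0 i.
have : \forall N \near \oo, simplex `<=` good N.
  apply: (near_covering_withinP _).2 => //; first exact/compact_near_coveringP/compact_simplex.
  move=> u su; have [i vi] := no u su.
  have [e e0 He] := within_gt_ball (within_continuous_coord (i := i) cphi) su vi.
  have ui : 0 < u 0 i.
    have [u0 _] := su; rewrite lt_neqAle u0 andbT eq_sym; apply/eqP => ui0.
    have [/(_ i)v0 _] := sv; have := lt_le_trans vi.
    by rewrite face // => /(_ _ v0); rewrite ltxx.
  pose del := Num.min (e / 2) (u 0 i / 2).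
  have del0 : 0 < del by rewrite lt_min !divr_gt0.
  near=> u' N => su'; exists i.
  have bu : ball u del u' by near: u'; exact: nbhsx_ballx.
  have dN : d%:R / N%:R < del by near: N; exact: near_natV_lt.
  have dl1 : del <= e / 2 by rewrite ge_min lexx.
  have dl2 : del <= u 0 i / 2 by rewrite ge_min lexx orbT.
  case: bu => _ bu; split.
    have := bu 0 i; rewrite /ball /= ltr_norml; lra.
  move=> w sw uw; apply: He => //; split=> // k j; rewrite (ord1 k) /ball /=.
  have := bu 0 j; rewrite /ball /= => b1; have b2 := uw j.
  have -> : u 0 j - w 0 j = (u 0 j - u' 0 j) + (u' 0 j - w 0 j) by lra.
  by apply: le_lt_trans (ler_normD _ _) _; lra.
move=> /(filterI (nbhs_infty_gt 0)) /filter_ex[N [N_gt0 goodN]].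
pose g (p : 'I_d -> nat) : 'rV[R]_d := \row_i ((p i)%:R / N%:R).
have N0 : 0 < N%:R :> R by rewrite ltr0n.
have sg p : (\sum_i p i)%N = N -> simplex (g p).
  move=> sp; split=> [i|]; first by rewrite mxE divr_ge0.
  under eq_bigr do rewrite mxE.
  by rewrite -mulr_suml -natr_sum sp divff // gt_eqF.
pose c (p : 'I_d -> nat) : 'I_d :=
  odflt (Ordinal (ltnW d_gt1)) [pick i | phi (g p) 0 i <= v 0 i].
have cP p : (\sum_i p i)%N = N -> phi (g p) 0 (c p) <= v 0 (c p).
  move=> sp; rewrite /c; case: pickP => //= no'.
  have sgp := sphi _ (sg p sp).
  have vphi : v = phi (g p).
    apply: simplex_le_eq => // i; apply: ltW.
    by have := no' i; rewrite leNgt => /negbFE.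
  by rewrite -vphi.
have [p [sp cl]] := multicolored_grid_cluster N c d_gt1.
have [i [di Hi]] := goodN _ (sg p sp).
have dp : (d <= p i)%N.
  by move: di; rewrite mxE ltr_pM2r ?invr_gt0 // ltr_nat => /ltnW.
have [q [sq cq pq]] := cl i dp.
suff /Hi : forall j, `|g p 0 j - g q 0 j| <= d%:R / N%:R.
  by move=> /(_ (sg q sq)); rewrite ltNge -cq cP.
move=> j; rewrite !mxE -mulrBl normrM (gtr0_norm (x := _^-1)) ?invr_gt0 //.
rewrite ler_pM2r ?invr_gt0 // ler_norml.
have [] := pq j; rewrite -!(ler_nat R) !natrD; lra.
Unshelve. all: by end_near. Qed.

End Topology.

(** * Rays, faces and radial graphs *)

Section Radial.
Context {R : realType} {d : nat}.
Implicit Types (x y z u v w : 'rV[R]_d) (S : set 'rV[R]_d) (t s : R).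

(** The relation [lltv_on I] between points of [Cface I], where [I] is the
    support of [y]: no set of indices has to be carried along. *)
Definition face_lt x y : Prop :=
  y <> 0 /\ forall i, x 0 i < y 0 i \/ x 0 i = 0 /\ y 0 i = 0.

Lemma Cplus_simplex u : simplex u -> Cplus u.
Proof. by case. Qed.

Lemma CplusZ t x : 0 <= t -> Cplus x -> Cplus (t *: x).
Proof. by move=> t0 Cx i; rewrite mxE mulr_ge0. Qed.

Lemma simplex_neq0 u : simplex u -> u <> 0.
Proof.
case=> _ /eqP su E; move: su; rewrite E big1 => [|i _]; last by rewrite mxE.
by rewrite eq_sym oner_eq0.
Qed.

Lemma norm1_Cplus x : Cplus x -> norm1 x = \sum_i x 0 i.
Proof. by move=> Cx; apply: eq_bigr => i _; rewrite ger0_norm. Qed.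

Lemma norm1Z t x : 0 <= t -> norm1 (t *: x) = t * norm1 x.
Proof.
move=> t0; rewrite /norm1 mulr_sumr; apply: eq_bigr => i _.
by rewrite mxE normrM ger0_norm.
Qed.

Lemma norm1_simplex u : simplex u -> norm1 u = 1.
Proof. by case=> Cu su; rewrite norm1_Cplus. Qed.

Lemma norm1_ray t u : 0 <= t -> simplex u -> norm1 (t *: u) = t.
Proof. by move=> t0 su; rewrite norm1Z // norm1_simplex // mulr1. Qed.

Lemma radial_proj_ray t u : 0 < t -> simplex u -> radial_proj (t *: u) = u.
Proof.
move=> t0 su; rewrite /radial_proj norm1_ray ?(ltW t0) // scalerA.
by rewrite mulVf ?scale1r // gt_eqF.
Qed.

Lemma norm1_gt0 x : x <> 0 -> 0 < norm1 x.
Proof.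
move=> x0; rewrite lt_neqAle sumr_ge0 ?andbT // eq_sym.
apply/eqP => /eqP; rewrite psumr_eq0 // => /allP H; apply: x0.
apply/rowP => i; rewrite mxE; apply/eqP; rewrite -normr_eq0.
by apply: H; rewrite mem_index_enum.
Qed.

Lemma simplex_radial_proj x : Cplus x -> x <> 0 -> simplex (radial_proj x).
Proof.
move=> Cx /norm1_gt0 nx; split.
  by apply: CplusZ => //; rewrite invr_ge0 ltW.
under eq_bigr do rewrite mxE.
by rewrite -mulr_sumr -norm1_Cplus // mulVf // gt_eqF.
Qed.

Lemma radial_projK x : x <> 0 -> norm1 x *: radial_proj x = x.
Proof. by move=> /norm1_gt0 nx; rewrite scalerA divff ?scale1r // gt_eqF. Qed.

Lemma neq0_gt0 x : Cplus x -> x <> 0 -> exists i, 0 < x 0 i.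
Proof.
move=> Cx x0; apply: contrapT => H; apply: x0; apply/rowP => i; rewrite mxE.
apply/eqP; rewrite eq_le Cx andbT leNgt; apply/negP => xi.
by apply: H; exists i.
Qed.

Lemma continuous_norm1 : continuous (@norm1 R d).
Proof.
have /subspace_continuousP H :
    {within setT, continuous (fun x : 'rV[R]_d => \sum_i `|x 0 i|)}.
  apply: within_continuous_sum => i.
  apply: continuous_subspaceT => x.
  apply: (@cvg_norm _ _ _ (nbhs x)); exact: coord_continuous.
by move=> x; have := H x I; rewrite withinET.
Qed.

Lemma continuous_radial_proj x : x <> 0 -> {for x, continuous (@radial_proj R d)}.
Proof.
move=> /norm1_gt0 nx.
have cV : {for x, continuous (fun y => (@norm1 R d y)^-1)}.
  by apply: continuousV; [rewrite gt_eqF|exact: continuous_norm1].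
exact: (@cvgZ _ _ _ (nbhs x) _ _ _ _ _ cV cvg_id).
Qed.

(** * Order along faces *)

Lemma face_lt_lev x y : face_lt x y -> lev x y.
Proof. by case=> _ H i; case: (H i) => [/ltW|[-> ->]]. Qed.

Lemma face_lt_ltv x y : Cplus x -> face_lt x y -> ltv x y.
Proof.
move=> Cx xy; split; first exact: face_lt_lev.
move=> E; case: xy; rewrite -E => /(neq0_gt0 Cx)[i xi] /(_ i)[].
  by rewrite ltxx.
by case=> E0; rewrite E0 ltxx in xi.
Qed.

Lemma lev_face_lt x y z : Cplus x -> lev x y -> face_lt y z -> face_lt x z.
Proof.
move=> Cx xy [z0 yz]; split=> // i.
have [yzi|[y0 z0']] := yz i; first by left; exact: le_lt_trans yzi.
by right; split=> //; apply/eqP; rewrite eq_le Cx andbT -y0.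
Qed.

Lemma face_ltZr x y t : Cplus y -> 1 <= t -> face_lt x y -> face_lt x (t *: y).
Proof.
move=> Cy t1 [y0 xy]; have t0 : 0 < t by exact: lt_le_trans t1.
split=> [E|i].
  by apply: y0; move/eqP: E; rewrite scaler_eq0 gt_eqF //= => /eqP.
rewrite mxE; have [xyi|[x0 y0']] := xy i; last by right; rewrite y0' mulr0.
by left; apply: lt_le_trans xyi _; rewrite ler_peMl.
Qed.

Lemma face_lt_ray s t u : 0 <= s -> s < t -> simplex u ->
  face_lt (s *: u) (t *: u).
Proof.
move=> s0 st su; have t0 := le_lt_trans s0 st; split.
  move=> /(congr1 (@radial_proj R d)).
    by rewrite radial_proj_ray // /radial_proj scaler0; exact: simplex_neq0.
move=> i; rewrite !mxE; have [u0|ui] := eqVneq (u 0 i) 0.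
  by right; rewrite u0 !mulr0.
by left; rewrite ltr_pM2r // lt_neqAle eq_sym ui (Cplus_simplex su).
Qed.

Definition no_face_lt S := forall x y, S x -> S y -> ~ face_lt x y.

Lemma no_face_lt_weakly_unordered S : S `<=` Cplus -> no_face_lt S -> weakly_unordered S.
Proof.
move=> SC nS I /finset.set0Pn[k kI] x y [Sx [_ xI]] [Sy [Cy yI]] _ xy.
apply: (nS x y Sx Sy); split.
  move=> y0; have := xy k kI; rewrite y0 mxE ltNge => /negP; apply.
  exact: SC.
move=> i; have [iI|iI] := boolP (i \in I); first by left; exact: xy.
by right; rewrite xI ?yI.
Qed.

(** * Radial graphs *)

Lemma LambdaP (kappa : R) x : Lambda kappa x <-> forall i, 0 <= x 0 i <= 1 + kappa.
Proof.
have E i : ((1 + kappa) *: onesv : 'rV[R]_d) 0 i = 1 + kappa.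
  rewrite mxE /onesv summxE (bigD1 i) //= big1 => [|j ji].
    by rewrite !mxE !eqxx addr0 mulr1.
  by rewrite mxE eq_sym (negPf ji) andbF.
split=> [[Cx _ xk] i|H]; first by rewrite Cx -(E i) xk.
by split=> i; rewrite ?E ?mxE; case/andP: (H i).
Qed.

Lemma Lambda_Cplus (kappa : R) : Lambda kappa `<=` @Cplus R d.
Proof. by move=> x []. Qed.

Lemma norm1_Lambda (kappa : R) x : Lambda kappa x -> norm1 x <= d%:R * (1 + kappa).
Proof.
move=> Lx; rewrite norm1_Cplus; last exact: Lambda_Cplus Lx.
rewrite mulr_natl -[X in _ <= _ *+ X]card_ord -sumr_const.
by apply: ler_sum => i _; have /LambdaP/(_ i)/andP[] := Lx.
Qed.

Lemma compact_Lambda (kappa : R) : compact (@Lambda R d kappa).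
Proof.
have := @compact_box R d 0 (1 + kappa).
by congr compact; apply/seteqP; split => x; rewrite LambdaP.
Qed.

Lemma is_radial_rep_mem S r u : is_radial_rep S r -> simplex u -> S (r u *: u).
Proof. by move=> [_ _ ->] su; exists u. Qed.

Lemma is_radial_rep_val S r t u : is_radial_rep S r -> simplex u -> 0 < t ->
  S (t *: u) -> t = r u.
Proof.
move=> [_ r0 ->] su t0 [v sv E]; have rv := r0 v sv.
have uv : v = u by rewrite -(radial_proj_ray rv sv) E radial_proj_ray.
by rewrite -(norm1_ray (ltW t0) su) -E uv norm1_ray // -uv ltW.
Qed.

Lemma is_radial_rep_inv S r x : is_radial_rep S r -> S x ->
  exists u, [/\ simplex u, 0 < r u & x = r u *: u].
Proof. by move=> [_ r0 ->] [u su <-]; exists u; split=> //; exact: r0. Qed.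

Lemma radial_repP S r : is_radial_rep S r -> is_radial_rep S (radial_rep S).
Proof. by move=> Sr; apply: xgetPex; exists r. Qed.

Lemma continuous_ray (r : 'rV[R]_d -> R) : {within simplex, continuous r} ->
  {within simplex, continuous (fun u => r u *: u)}.
Proof.
move=> cr; apply: within_continuous_rV => i u.
rewrite (_ : (fun _ => _) = (fun u => r u * u 0 i)); last first.
  by apply/funext => v; rewrite mxE.
apply: (@continuousM _ (subspace simplex)); first exact: cr.
by move: u; apply: continuous_subspaceT; exact: coord_continuous.
Qed.

Lemma compact_radial_set S r : is_radial_rep S r -> compact S.
Proof.
move=> [cr _ ->]; apply: continuous_compact; last exact: compact_simplex.
exact: continuous_ray.
Qed.

(** The members of [Uhat kappa], given by a radius function instead of a
    homeomorphism. *)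
Definition Ugraph (kappa : R) S :=
  [/\ S `<=` Lambda kappa, no_face_lt S & exists r, is_radial_rep S r].

Lemma Ugraph_neq0 kappa S x : Ugraph kappa S -> S x -> x <> 0.
Proof.
move=> [_ _ [r Sr]] /(is_radial_rep_inv Sr)[u [su ru ->]] E.
have E0 : r u = 0.
  by rewrite -(norm1_ray (ltW ru) su) E /norm1 big1 // => i _; rewrite mxE normr0.
by rewrite E0 ltxx in ru.
Qed.

Lemma Ugraph_Uhat kappa S : Ugraph kappa S -> Uhat kappa S.
Proof.
move=> gS; have [SL nS [r Sr]] := gS; split; last first.
  apply: no_face_lt_weakly_unordered => //; exact: (subset_trans SL (@Lambda_Cplus _)).
split=> [x Sx|]; first by split; [exact: SL|exact: Ugraph_neq0 gS Sx].
split.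
- apply: continuous_in_subspaceT => x /set_mem Sx.
  by apply: continuous_radial_proj; exact: Ugraph_neq0 gS Sx.
- split=> [x Sx|x y /set_mem Sx /set_mem Sy|u su].
  + by apply: simplex_radial_proj; [exact/Lambda_Cplus/SL|exact: Ugraph_neq0 gS Sx].
  + have [u [su ru ->]] := is_radial_rep_inv Sr Sx.
    have [v [sv rv ->]] := is_radial_rep_inv Sr Sy.
    by rewrite !radial_proj_ray // => ->.
  + exists (r u *: u); first exact: is_radial_rep_mem Sr su.
    by rewrite radial_proj_ray //; case: Sr => _ r0 _; exact: r0.
- exists (fun u => r u *: u); split; first by case: Sr => cr _ _; exact: continuous_ray.
  move=> x /(is_radial_rep_inv Sr)[u [su ru ->]].
  by rewrite radial_proj_ray.
Qed.

(** The radius function is continuous because a closed set that omits the points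
    [t *: u] with [t] away from [r u] also omits the points [t *: w] for [w] near
    [u], uniformly for [t] in a compact interval. *)
Lemma compact_Ugraph kappa S : compact S -> S `<=` Lambda kappa -> ~ S 0 ->
  no_face_lt S -> (forall u, simplex u -> exists2 t, 0 < t & S (t *: u)) ->
  Ugraph kappa S.
Proof.
move=> cS SL S0 nS hit; split=> //.
have /choice[r rP] : forall u, exists t, simplex u -> 0 < t /\ S (t *: u).
  move=> u; have [su|nsu] := pselect (simplex u); last by exists 0.
  by have [t t0 St] := hit u su; exists t.
have uniq t s u : simplex u -> 0 < t -> 0 < s -> S (t *: u) -> S (s *: u) -> t = s.
  move=> su t0 s0 St Ss; apply/eqP; rewrite eq_le !leNgt.
  by apply/andP; split; apply/negP => lt;
    [apply: (nS _ _ Ss St)|apply: (nS _ _ St Ss)]; apply: face_lt_ray => //; exact: ltW.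
have clS : closed S by apply: compact_closed => //; exact: norm_hausdorff.
pose B := d%:R * (1 + kappa).
have rB u : simplex u -> r u <= B.
  move=> su; have [r0 Sru] := rP u su.
  by rewrite -(norm1_ray (ltW r0) su) norm1_Lambda //; exact: SL.
exists r; split.
- apply/subspace_continuousP => u su; apply/cvg_ballP => e e0.
  have [r0 Sru] := rP u su.
  have : \forall w \near nbhs u, `[0, B] `<=` [set t | `|r u - t| < e \/ ~ S (t *: w)].
    have /compact_near_coveringP := @segment_compact R 0 B.
    apply => t _; have [->|tr] := eqVneq t (r u).
      exists (ball (r u) e, setT).
        by split; [exact: nbhsx_ballx|exact: filterT].
      by move=> [t' w] [/= ? _]; left.
    have nSt : (~` S) (t *: u).
      move=> St; have [t0|t0] := ltrP 0 t.
        by move/eqP: tr; apply; exact: uniq St Sru.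
      have [Et|tn] := eqVneq t 0; first by apply: S0; move: St; rewrite Et scale0r.
      have [i ui] := neq0_gt0 (Cplus_simplex su) (simplex_neq0 su).
      have /Lambda_Cplus/(_ i) := SL _ St; rewrite mxE leNgt => /negP; apply.
      by rewrite nmulr_rlt0 // lt_neqAle tn.
    have cs := @scale_continuous _ _ (t, u).
    have := cs (~` S) (open_nbhs_nbhs (conj (closed_openC clS) nSt)).
    case=> -[/= P Q] [nP nQ] PQ.
    exists (P, Q) => //= -[t' w] /= H; right; exact: (PQ (t', w)).
  move=> H; rewrite near_withinE; apply: filterS H => w Hw sw.
  have [rw Srw] := rP w sw; have := Hw (r w).
  by rewrite /= in_itv /= (ltW rw) rB // => /(_ isT)[].
- by move=> u /rP[].
- apply/seteqP; split => [x Sx|_ [u /rP[_ Sru] <-]] //.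
  have x0 : x <> 0 by move=> E; rewrite E in Sx.
  have sx := simplex_radial_proj (Lambda_Cplus (SL _ Sx)) x0.
  exists (radial_proj x) => //; rewrite -[RHS](radial_projK x0); congr (_ *: _).
  have [rx Srx] := rP _ sx; apply: uniq Srx _ => //; first exact: norm1_gt0.
  by rewrite radial_projK.
Qed.

End Radial.

(** * Increasing limits of radial graphs *)

Section Limit.
Context {R : realType} {d : nat}.
Implicit Types (u v w : 'rV[R]_d) (S : set 'rV[R]_d) (t s : R).

Lemma within_near_gt (T : topologicalType) (A : set T) (h : T -> R) x a :
  {within A, continuous h} -> A x -> a < h x ->
  \forall y \near x, A y -> a < h y.
Proof.
by move=> /subspace_continuousP ch Ax ax; exact: (ch x Ax _ (lt_nbhsr ax)).
Qed.

Lemma within_near_lt (T : topologicalType) (A : set T) (h : T -> R) x a :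
  {within A, continuous h} -> A x -> h x < a ->
  \forall y \near x, A y -> h y < a.
Proof.
by move=> /subspace_continuousP ch Ax ax; exact: (ch x Ax _ (lt_nbhsl ax)).
Qed.

Lemma uniform_cvgn (T : choiceType) (A : set T) (h : nat -> T -> R) (l : T -> R) :
  (forall e, 0 < e -> \forall n \near \oo, forall x, A x -> `|l x - h n x| < e) ->
  {uniform A, h n @[n --> \oo] --> l}.
Proof.
move=> H W /uniform_nbhs[E [entE sub]].
move: entE; rewrite -entourage_ballE => -[e /= e0 He].
apply: filterS (H e e0) => n Hn; apply: sub => x Ax; apply: He.
exact: Hn.
Qed.

(** For [w] near [u] the support of [w] contains that of [u]. If [l w] were at
    least [l u + e], the point [l w *: w] would be strictly above [l u *: u] on the
    whole support of [w], also when [u] is on the boundary of the simplex. *)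
Lemma no_face_lt_usc (l : 'rV[R]_d -> R) u e :
  (forall w, simplex w -> 0 < l w) -> no_face_lt (radial_set l) ->
  simplex u -> 0 < e -> \forall w \near u, simplex w -> l w < l u + e.
Proof.
move=> l0 nl su e0; have lu := l0 u su; have lue : 0 < l u + e by rewrite addr_gt0.
have : \forall w \near u, forall i, 0 < u 0 i -> l u * u 0 i < (l u + e) * (w : 'rV[R]_d) 0 i.
  apply: (@filter_forall _ _ _ (nbhs u)) => i.
  have [ui|ui] := ltrP 0 (u 0 i); last by apply: nearW => w.
  have H : l u * u 0 i / (l u + e) < u 0 i.
    by rewrite ltr_pdivrMr // mulrC ltr_pM2l // ltrDl.
  have : \forall w \near u, [set: 'rV[R]_d] w -> l u * u 0 i / (l u + e) < (w : 'rV[R]_d) 0 i.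
    apply: (within_near_gt (h := fun w => w 0 i)) => //.
    by apply: continuous_subspaceT; exact: coord_continuous.
  apply: filterS => w Hw _; rewrite [ltRHS]mulrC -ltr_pdivrMr //; exact: Hw.
apply: filterS => w Hw sw; rewrite ltNge; apply/negP => le.
apply: (nl (l u *: u) (l w *: w)); [by exists u|by exists w|split].
  move=> E; have := norm1_ray (ltW (l0 w sw)) sw.
  rewrite E /norm1 big1 => [E0|i _]; last by rewrite mxE normr0.
  by have := l0 w sw; rewrite -E0 ltxx.
move=> i; rewrite !mxE; have [ui|ui] := ltrP 0 (u 0 i).
  left; apply: lt_le_trans (Hw i ui) _; apply: ler_wpM2r => //.
  exact: Cplus_simplex sw i.
have -> : u 0 i = 0.
  by apply/eqP; rewrite eq_le ui (Cplus_simplex su).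
rewrite mulr0; have [->|wi] := eqVneq (w 0 i) 0; first by right; rewrite mulr0.
by left; rewrite mulr_gt0 ?l0 // lt_neqAle eq_sym wi (Cplus_simplex sw).
Qed.

Section Increasing.
Variables (kappa : R) (S_ : nat -> set 'rV[R]_d) (r : nat -> 'rV[R]_d -> R).
Hypothesis S_Ugraph : forall n, Ugraph kappa (S_ n).
Hypothesis r_rep : forall n, is_radial_rep (S_ n) (r n).
Hypothesis r_le : forall n u, simplex u -> r n u <= r n.+1 u.

Let l u := lim (r n u @[n --> \oo]).

Lemma increasing_rep u m n : simplex u -> (m <= n)%N -> r m u <= r n u.
Proof.
move=> su; elim: n => [|n IH]; first by rewrite leqn0 => /eqP ->.
rewrite leq_eqVlt => /orP[/eqP -> //|]; rewrite ltnS => /IH rmn.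
exact: le_trans rmn (r_le _ su).
Qed.

Lemma rep_gt0 n u : simplex u -> 0 < r n u.
Proof. by case: (r_rep n) => _ r0 _; exact: r0. Qed.

Lemma rep_coord_le n u i : simplex u -> r n u * u 0 i <= 1 + kappa.
Proof.
move=> su; have [SL _ _] := S_Ugraph n.
have /LambdaP/(_ i) := SL _ (is_radial_rep_mem (r_rep n) su).
by rewrite mxE => /andP[].
Qed.

Lemma rep_cvg u : simplex u -> cvgn (r ^~ u).
Proof.
move=> su; apply: nondecreasing_is_cvgn; first by move=> m n; exact: increasing_rep.
have [i ui] := neq0_gt0 (Cplus_simplex su) (simplex_neq0 su).
exists ((1 + kappa) / u 0 i) => _ [n _ <-].
by rewrite ler_pdivlMr // rep_coord_le.
Qed.

Lemma rep_le_lim n u : simplex u -> r n u <= l u.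
Proof.
move=> su; apply: nondecreasing_cvgn_le; last exact: rep_cvg.
by move=> m k; exact: increasing_rep.
Qed.

Lemma lim_gt0 u : simplex u -> 0 < l u.
Proof. by move=> su; apply: lt_le_trans (rep_gt0 0 su) (rep_le_lim 0 su). Qed.

Lemma rep_gt_below_lim u a : simplex u -> a < l u -> exists n, a < r n u.
Proof.
move=> su al.
have : \forall n \near \oo, a < r n u := rep_cvg su (lt_nbhsr al).
by move=> /filter_ex[n ?]; exists n.
Qed.

Lemma lim_Lambda : radial_set l `<=` Lambda kappa.
Proof.
move=> _ [u su <-]; apply/LambdaP => i; rewrite mxE.
have ui := Cplus_simplex su i.
rewrite mulr_ge0 ?(ltW (lim_gt0 su)) //=.
have [->|ui0] := eqVneq (u 0 i) 0.
  rewrite mulr0; apply: le_trans (rep_coord_le 0 i su).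
  by rewrite mulr_ge0 // ltW // rep_gt0.
have {}ui : 0 < u 0 i by rewrite lt_neqAle eq_sym ui0.
rewrite -ler_pdivlMr //; apply: limr_le; first exact: rep_cvg.
by apply: nearW => n; rewrite ler_pdivlMr // rep_coord_le.
Qed.

(** If two points of the limit graph were related, so would be the points of the
    [n]th graph on the same rays for large [n]: the lower one can only be smaller
    than its limit and the upper one converges. *)
Lemma lim_no_face_lt : no_face_lt (radial_set l).
Proof.
move=> _ _ [u su <-] [v sv <-] [_ uv].
have /filter_ex[n Hn] : \forall n \near \oo, forall i,
    l u * u 0 i < l v * v 0 i -> l u * u 0 i < r n v * v 0 i.
  apply: filter_forall => i.
  have [luv|] := ltrP (l u * u 0 i) (l v * v 0 i); last by move=> ?; apply: nearW.
  have vi : 0 < v 0 i.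
    rewrite lt_neqAle (Cplus_simplex sv) andbT; apply/eqP => E; move: luv.
    by rewrite -E mulr0 ltNge mulr_ge0 ?(Cplus_simplex su) // ltW // lim_gt0.
  have H : l u * u 0 i / v 0 i < l v by rewrite ltr_pdivrMr.
  have : \forall n \near \oo, l u * u 0 i / v 0 i < r n v := rep_cvg sv (lt_nbhsr H).
  by apply: filterS => n /= + _; rewrite ltr_pdivrMr.
have [_ nS _] := S_Ugraph n.
apply: (nS (r n u *: u) (r n v *: v)).
- exact: (is_radial_rep_mem (r_rep n) su).
- exact: (is_radial_rep_mem (r_rep n) sv).
split=> [E|i].
  by apply: (Ugraph_neq0 (S_Ugraph n) (is_radial_rep_mem (r_rep n) sv) E).
have := uv i; rewrite !mxE => -[/Hn lt|[lu lv]].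
  left; apply: le_lt_trans lt; apply: ler_wpM2r; last exact: rep_le_lim.
  exact: Cplus_simplex.
by right; split; apply/eqP; rewrite mulf_eq0 orbC;
  [move/eqP: lu|move/eqP: lv]; rewrite mulf_eq0 (gt_eqF (lim_gt0 _)) //= => ->.
Qed.

(** Dini's argument, with [no_face_lt_usc] in place of the continuity of the
    limit. *)
Lemma lim_uniform : {uniform simplex, r n @[n --> \oo] --> l}.
Proof.
apply: uniform_cvgn => e e0.
have : \forall n \near \oo, simplex `<=` [set u | `|l u - r n u| < e].
  apply: (near_covering_withinP _).2 => //.
    exact/compact_near_coveringP/compact_simplex.
  move=> u su; have e2 : 0 < e / 2 by rewrite divr_gt0.
  have [m Hm] : exists m, l u - e / 2 < r m u.
    by apply: rep_gt_below_lim; rewrite // ltrBlDr ltrDl.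
  have [cr _ _] := r_rep m.
  have near1 := within_near_gt cr su Hm.
  have near2 := no_face_lt_usc lim_gt0 lim_no_face_lt su e2.
  near=> w n => sw; rewrite /= ger0_norm ?subr_ge0 ?rep_le_lim //.
  have rmn : r m w <= r n w by apply: increasing_rep => //; near: n; exact: nbhs_infty_ge.
  have : l u - e / 2 < r m w by apply: (near near1 w).
  have : l w < l u + e / 2 by apply: (near near2 w).
  lra.
by [].
Unshelve. all: by end_near. Qed.

Lemma lim_is_radial_rep : is_radial_rep (radial_set l) l.
Proof.
split=> //; last exact: lim_gt0.
have H : \forall n \near \oo, {within simplex, continuous (r n)}.
  by apply: nearW => n; case: (r_rep n).
exact (@uniform_limit_continuous_subspace 'rV[R]_d R simplex
  (r n @[n --> \oo]) l _ H lim_uniform).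
Qed.

Lemma lim_Ugraph : Ugraph kappa (radial_set l).
Proof.
split; [exact: lim_Lambda|exact: lim_no_face_lt|exists l; exact: lim_is_radial_rep].
Qed.

End Increasing.
End Limit.

(** * Iteration of the map *)

Section Dynamics.
Context {R : realType} {d : nat}.
Implicit Types (x y z u v w : 'rV[R]_d) (S : set 'rV[R]_d) (t s : R).
Variables (f : 'rV[R]_d -> 'rV[R]_d) (kappa : R).
Hypothesis f_cont : {within Cplus, continuous f}.
Hypothesis f_pos : forall x, Cplus x -> lltv 0 (f x).
Hypothesis f_unit : forall i, f (unitv i) 0 i = 1.
Hypothesis kappa_gt0 : 0 < kappa.
Hypothesis F_wretro : weakly_retrotone (kolmogorov f) (Lambda kappa).
Hypothesis beta : condition_beta kappa f.

Let F := kolmogorov f.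

Lemma kolmogorovE x i : F x 0 i = x 0 i * f x 0 i.
Proof. by rewrite mxE. Qed.

Lemma fitness_gt0 x i : Cplus x -> 0 < f x 0 i.
Proof. by move=> Cx; have := f_pos Cx i; rewrite mxE. Qed.

Lemma kolmogorov_Cplus x : Cplus x -> Cplus (F x).
Proof. by move=> Cx i; rewrite kolmogorovE mulr_ge0 // ltW // fitness_gt0. Qed.

Lemma kolmogorov_eq0 x i : Cplus x -> (F x 0 i == 0) = (x 0 i == 0).
Proof. by move=> Cx; rewrite kolmogorovE mulf_eq0 orbC gt_eqF // fitness_gt0. Qed.

Lemma kolmogorov_neq0 x : Cplus x -> x <> 0 -> F x <> 0.
Proof.
move=> Cx x0 F0; apply: x0; apply/rowP => i; rewrite [RHS]mxE; apply/eqP.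
by rewrite -kolmogorov_eq0 // F0 mxE.
Qed.

Lemma continuous_kolmogorov : {within Cplus, continuous F}.
Proof.
apply: within_continuous_rV => i x.
rewrite (_ : (fun _ => _) = (fun y : 'rV[R]_d => y 0 i * f y 0 i)); last first.
  by apply/funext => y; rewrite kolmogorovE.
apply: (@continuousM _ (subspace Cplus)).
  by move: x; apply: continuous_subspaceT; exact: coord_continuous.
by move: x; exact: within_continuous_coord.
Qed.

Lemma kolmogorov_face_lt x y : Lambda kappa x -> Lambda kappa y ->
  face_lt (F x) (F y) -> face_lt x y.
Proof.
move=> Lx Ly Fxy; have [Fy0 FI] := Fxy.
have [Cx Cy] := (Lambda_Cplus Lx, Lambda_Cplus Ly).
pose I := [set i | F x 0 i < F y 0 i]%SET.
have Fltv := face_lt_ltv (kolmogorov_Cplus Cx) Fxy.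
have [|_ xyI] := F_wretro Lx Ly Fltv (I := I).
  by move=> i; rewrite finset.in_set.
split=> [y0|i].
  apply: Fy0; apply/rowP => i; apply/eqP.
  by rewrite [X in _ == X]mxE kolmogorov_eq0 // y0 mxE.
have [Fi|[/eqP Fx0 /eqP Fy0']] := FI i.
  by left; apply: xyI; rewrite finset.in_set.
by right; split; apply/eqP; rewrite -kolmogorov_eq0.
Qed.

(** Let [a] be the end point of the [i]th axis of [Lambda kappa]. Since
    [f (unitv i) 0 i] is 1, condition (beta) on that axis forces [f a 0 i < 1],
    whence [F a 0 i < 1 + kappa]. By weak retrotonicity [F x 0 i] cannot exceed
    [F a 0 i], as [x 0 i] does not exceed [a 0 i]. *)
Lemma kolmogorov_lt x i : Lambda kappa x -> F x 0 i < 1 + kappa.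
Proof.
move=> Lx; have Cx := Lambda_Cplus Lx.
have k0 : 0 < 1 + kappa by rewrite addr_gt0.
pose a : 'rV[R]_d := (1 + kappa) *: unitv i.
have uE j : (unitv i : 'rV[R]_d) 0 j = (j == i)%:R by rewrite mxE eqxx.
have aE j : a 0 j = if j == i then 1 + kappa else 0.
  by rewrite mxE uE; case: eqP => _; rewrite ?mulr1 ?mulr0.
have Le : Lambda kappa (unitv i).
  apply/LambdaP => j; rewrite uE; case: eqP => _.
    by rewrite ler01 lerDl ltW.
  by rewrite lexx ltW.
have La : Lambda kappa a.
  by apply/LambdaP => j; rewrite aE; case: eqP => _; rewrite lexx ?(ltW k0).
have Fe j : F (unitv i) 0 j = (j == i)%:R.
  by rewrite kolmogorovE uE; case: eqP => [->|_]; rewrite ?mul0r // f_unit mul1r.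
have Fa j : F a 0 j = if j == i then (1 + kappa) * f a 0 i else 0.
  by rewrite kolmogorovE aE; case: eqP => [->|_]; rewrite ?mul0r.
have fa : f a 0 i < 1.
  rewrite ltNge; apply/negP => fa1.
  have Fi : F (unitv i) 0 i < F a 0 i.
    rewrite Fe Fa eqxx; apply: (@lt_le_trans _ _ (1 + kappa)); first by rewrite ltrDl.
    by rewrite ler_peMr // ltW.
  have Fea : ltv (F (unitv i)) (F a).
    split=> [j|E]; last by rewrite E ltxx in Fi.
    by have [->|ji] := eqVneq j i; [exact: ltW|rewrite Fe Fa (negPf ji)].
  have [_ /(_ i Fi)[]] := beta Le La Fea.
    by rewrite uE eqxx => /eqP; rewrite oner_eq0.
  by rewrite f_unit ltNge fa1.
rewrite ltNge; apply/negP => Fx.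
have Fai : F a 0 i < F x 0 i.
  by apply: lt_le_trans Fx; rewrite Fa eqxx gtr_pMr.
have [|i' |_ /(_ i)] := F_wretro La Lx (I := [set i]%SET).
- split=> [j|E]; last by move: Fai; rewrite /F E ltxx.
  have [->|ji] := eqVneq j i; first exact: ltW.
  by rewrite -/F Fa (negPf ji) kolmogorov_Cplus.
- by rewrite finset.in_set1 => /eqP ->.
rewrite finset.in_set1 eqxx => /(_ isT); rewrite aE eqxx ltNge.
by have /LambdaP/(_ i)/andP[_ ->] := Lx.
Qed.

Lemma kolmogorov_Lambda x : Lambda kappa x -> Lambda kappa (F x).
Proof.
move=> Lx; apply/LambdaP => i; rewrite (ltW (kolmogorov_lt i Lx)) andbT.
exact/kolmogorov_Cplus/Lambda_Cplus/Lx.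
Qed.

(** The image meets each ray at most once because [F] reflects [face_lt], and at
    least once by [face_preserving_onto] applied to the direction of [F]. *)
Lemma Ugraph_kolmogorov S : Ugraph kappa S -> Ugraph kappa (F @` S).
Proof.
move=> gS; have [SL nS [r Sr]] := gS; have SC := subset_trans SL (@Lambda_Cplus _ _ _).
apply: compact_Ugraph.
- apply: continuous_compact (compact_radial_set Sr).
  exact: continuous_subspaceW SC continuous_kolmogorov.
- by move=> _ [x Sx <-]; exact/kolmogorov_Lambda/SL.
- move=> [x Sx]; apply: kolmogorov_neq0; [exact: SC|exact: Ugraph_neq0 gS Sx].
- move=> _ _ [x Sx <-] [y Sy <-] Fxy; apply: (nS x y Sx Sy).
  by apply: kolmogorov_face_lt => //; exact: SL.
move=> v sv; pose p u := r u *: u.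
have Sp u : simplex u -> S (p u) by exact: (is_radial_rep_mem Sr).
have Fp0 u : simplex u -> F (p u) <> 0.
  by move=> su; apply: kolmogorov_neq0; [exact/SC/Sp|exact: Ugraph_neq0 gS (Sp u su)].
have FpC u : simplex u -> Cplus (F (p u)) by move=> su; exact/kolmogorov_Cplus/SC/Sp.
have [||u i su u0|u su <-] :=
  @face_preserving_onto _ _ (fun u => radial_proj (F (p u))) _ _ _ v sv.
- apply: (@within_continuous_comp _ _ _ _ (F \o p)).
    by move=> _ /set_mem[u su <-]; apply: continuous_radial_proj; exact: Fp0.
  apply: within_comp continuous_kolmogorov; last by move=> u su; exact/SC/Sp.
  by apply: continuous_ray; case: Sr.
- by move=> u su; apply: simplex_radial_proj; [exact: FpC|exact: Fp0].
- by rewrite mxE kolmogorovE mxE u0 !(mulr0, mul0r).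
exists (norm1 (F (p u))); first by apply: norm1_gt0; exact: Fp0.
by rewrite radial_projK; [exists (p u) => //; exact: Sp|exact: Fp0].
Qed.

Lemma Ugraph_radial_rep S : Ugraph kappa S -> is_radial_rep S (radial_rep S).
Proof. by case=> _ _ [r Sr]; exact: radial_repP Sr. Qed.

(** If the image of [S] were above that of [S'] on some ray, [F] would reflect
    this to a point of [S'] strictly below a point [a] of [S]; the point of [S] on
    the ray of the former would be strictly below [a] too. *)
Lemma radial_rep_kolmogorov_le S S' : Ugraph kappa S -> Ugraph kappa S' ->
  (forall u, simplex u -> radial_rep S u <= radial_rep S' u) ->
  forall u, simplex u -> radial_rep (F @` S) u <= radial_rep (F @` S') u.
Proof.
move=> gS gS' le u su; rewrite leNgt; apply/negP => lt.
have rS := Ugraph_radial_rep gS; have rS' := Ugraph_radial_rep gS'.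
have rF := Ugraph_radial_rep (Ugraph_kolmogorov gS).
have rF' := Ugraph_radial_rep (Ugraph_kolmogorov gS').
have [[a Sa Ea] [b Sb Eb]] := (is_radial_rep_mem rF su, is_radial_rep_mem rF' su).
have [SL nS _] := gS; have [SL' nS' _] := gS'.
have ba : face_lt b a.
  apply: kolmogorov_face_lt; [exact: SL'|exact: SL|].
  rewrite Ea Eb; apply: face_lt_ray => //.
  by case: rF' => _ r0 _; exact/ltW/r0.
have [v [sv rv Ev]] := is_radial_rep_inv rS' Sb.
have Sv := is_radial_rep_mem rS sv.
apply: (nS _ _ Sv Sa); apply: lev_face_lt ba; first exact/Lambda_Cplus/SL/Sv.
move=> i; rewrite Ev !mxE ler_wpM2r ?le //; exact: Cplus_simplex.
Qed.

(** * The two iterated sequences *)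

Lemma S_lower_succ eps n : S_lower f eps n.+1 = F @` S_lower f eps n.
Proof. exact: esym (image_comp (iter n F) F _). Qed.

Lemma S_upper_succ n : S_upper f kappa n.+1 = F @` S_upper f kappa n.
Proof. exact: esym (image_comp (iter n F) F _). Qed.

Section Lower.
Variable eps : R.
Hypothesis eps_gt0 : 0 < eps.
Hypothesis eps_lt1 : eps < 1.
Hypothesis eps_small : forall x, Cplus x -> \sum_i x 0 i <= eps ->
  forall i, 1 < f x 0 i.

Lemma Ugraph_S_lower0 : Ugraph kappa (S_lower f eps 0).
Proof.
rewrite /S_lower image_id; split.
- move=> _ [u su <-]; apply/LambdaP => i; have [Cu su1] := su.
  rewrite mxE mulr_ge0 ?(ltW eps_gt0) //=.
  have u1 : u 0 i <= 1 by rewrite -su1 (bigD1 i) //= lerDl sumr_ge0.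
  apply: (@le_trans _ _ 1); last by rewrite lerDl ltW.
  by apply: mulr_ile1 => //; exact: ltW.
- move=> _ _ [u su <-] [v sv <-] lt.
  have := face_lt_lev lt; have [_] := face_lt_ltv (CplusZ (ltW eps_gt0) (Cplus_simplex su)) lt.
  move=> nuv uv; apply: nuv; congr (_ *: _); apply: simplex_le_eq => // i.
  by have := uv i; rewrite !mxE ler_pM2l.
- exists (cst eps); split=> //; by move=> u; exact: cst_continuous.
Qed.

Lemma Ugraph_S_lower n : Ugraph kappa (S_lower f eps n).
Proof.
elim: n => [|n IH]; first exact: Ugraph_S_lower0.
by rewrite S_lower_succ; exact: Ugraph_kolmogorov.
Qed.

Lemma R_lower_rep n : is_radial_rep (S_lower f eps n) (R_lower f eps n).
Proof. exact/Ugraph_radial_rep/Ugraph_S_lower. Qed.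

Lemma R_lower0 u : simplex u -> R_lower f eps 0 u = eps.
Proof.
move=> su; apply/esym/(is_radial_rep_val (R_lower_rep 0)) => //.
by rewrite /S_lower image_id; exists u.
Qed.

Lemma R_lower_le n u : simplex u -> R_lower f eps n u <= R_lower f eps n.+1 u.
Proof.
elim: n u => [|n IH] u su.
  rewrite R_lower0 //; have [_ r0 _] := R_lower_rep 1.
  rewrite -(norm1_ray (ltW (r0 u su)) su).
  have : S_lower f eps 1 (R_lower f eps 1 u *: u).
    exact: is_radial_rep_mem (R_lower_rep 1) su.
  rewrite S_lower_succ /S_lower image_id => -[_ [v sv <-] <-].
  have [Cv sv1] := sv; have Cx := CplusZ (ltW eps_gt0) Cv.
  have sx : \sum_i (eps *: v) 0 i = eps.
    by under eq_bigr do rewrite mxE; rewrite -mulr_sumr sv1 mulr1.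
  rewrite norm1_Cplus; last exact: kolmogorov_Cplus.
  rewrite -[leLHS]sx; apply: ler_sum => i _.
  by rewrite kolmogorovE ler_peMr ?Cx // ltW // eps_small // sx.
rewrite /R_lower (S_lower_succ _ n.+1) [in leLHS]S_lower_succ.
by apply: radial_rep_kolmogorov_le => //; exact: Ugraph_S_lower.
Qed.

Let l := R_star f eps.

Lemma S_star_rep : is_radial_rep (S_star f eps) l.
Proof. exact: lim_is_radial_rep Ugraph_S_lower R_lower_rep R_lower_le. Qed.

Lemma S_star_Ugraph : Ugraph kappa (S_star f eps).
Proof. exact: lim_Ugraph Ugraph_S_lower R_lower_rep R_lower_le. Qed.

Lemma R_lower_uniform : {uniform simplex, R_lower f eps n @[n --> \oo] --> l}.
Proof. exact: lim_uniform Ugraph_S_lower R_lower_rep R_lower_le. Qed.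

Lemma R_lower_le_star n u : simplex u -> R_lower f eps n u <= l u.
Proof. exact: rep_le_lim Ugraph_S_lower R_lower_rep R_lower_le _ _. Qed.

Lemma R_star_gt0 u : simplex u -> 0 < l u.
Proof. by case: S_star_rep => _ l0 _; exact: l0. Qed.

Lemma R_star_ge u : simplex u -> eps <= l u.
Proof. by move=> su; rewrite -(R_lower0 su); exact: R_lower_le_star. Qed.

Lemma S_lower_below_star n x : S_lower f eps n x ->
  exists2 t, 1 <= t & S_star f eps (t *: x).
Proof.
move=> /(is_radial_rep_inv (R_lower_rep n))[v [sv rv ->]].
exists (l v / R_lower f eps n v).
  by rewrite ler_pdivlMr // mul1r R_lower_le_star.
by exists v => //; rewrite scalerA divfK // gt_eqF.
Qed.

Lemma no_face_lt_star_lower n x y : S_star f eps x -> S_lower f eps n y ->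
  ~ face_lt x y.
Proof.
move=> Sx Sy xy; have [t t1 St] := S_lower_below_star Sy.
have [_ nS _] := S_star_Ugraph; apply: (nS _ _ Sx St).
apply: face_ltZr => //; have [SL _ _] := Ugraph_S_lower n; exact/Lambda_Cplus/SL.
Qed.

(** Both alternatives to [F x] being on [S_star f eps] produce a point of an
    iterate that is strictly above a point of [S_star f eps]. *)
Lemma S_star_sub : F @` S_star f eps `<=` S_star f eps.
Proof.
move=> _ [x Sx <-]; have [SL _ _] := S_star_Ugraph.
have Cx := Lambda_Cplus (SL _ Sx); have x0 := Ugraph_neq0 S_star_Ugraph Sx.
have Fx0 := kolmogorov_neq0 Cx x0; have CFx := kolmogorov_Cplus Cx.
have [w sw Fx] : exists2 w, simplex w & F x = norm1 (F x) *: w.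
  exists (radial_proj (F x)); first exact: simplex_radial_proj.
  by rewrite radial_projK.
have FxE i : F x 0 i = norm1 (F x) * w 0 i by rewrite {1}Fx mxE.
have nF0 := norm1_gt0 Fx0.
exists w => //; rewrite [RHS]Fx; congr (_ *: _); apply/eqP; rewrite eq_le !leNgt.
apply/andP; split; apply/negP => lt; last first.
  (* [F x] is strictly above [S_star f eps]; by continuity, so is the image of
     the point of the [n]th lower graph on the ray of [x], for large [n] *)
- have [u [su lu Ex]] := is_radial_rep_inv S_star_rep Sx.
  have cvx : R_lower f eps n u *: u @[n --> \oo] --> x.
    rewrite Ex; apply: cvgZr_tmp.
    exact: (rep_cvg Ugraph_S_lower R_lower_rep R_lower_le su).
  have /filter_ex[n Hn] : \forall n \near \oo, forall i,
      l w * w 0 i < F x 0 i -> l w * w 0 i < F (R_lower f eps n u *: u) 0 i.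
    apply: filter_forall => i.
    have [lFx|] := ltrP (l w * w 0 i) (F x 0 i); last by move=> ?; apply: nearW.
    have cF : {within Cplus, continuous (fun y => F y 0 i)}.
      exact: within_continuous_coord continuous_kolmogorov.
    have : \forall n \near \oo, Cplus (R_lower f eps n u *: u) ->
        l w * w 0 i < F (R_lower f eps n u *: u) 0 i := cvx _ (within_near_gt cF Cx lFx).
    apply: filterS => n H _; apply: H.
    apply: CplusZ; last exact: Cplus_simplex.
    by apply: ltW; case: (R_lower_rep n) => _ r0 _; exact: r0.
  have Sn := is_radial_rep_mem (R_lower_rep n) su.
  apply: (@no_face_lt_star_lower n.+1 (l w *: w) (F (R_lower f eps n u *: u))).
  + by exists w.
  + by rewrite S_lower_succ; exists (R_lower f eps n u *: u).
  have [SnL _ _] := Ugraph_S_lower n.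
  split.
    apply: kolmogorov_neq0 (Lambda_Cplus (SnL _ Sn)) _.
    exact: Ugraph_neq0 (Ugraph_S_lower n) Sn.
  move=> i; have [w0|wi] := eqVneq (w 0 i) 0; last first.
    left; rewrite mxE; apply: Hn; rewrite FxE ltr_pM2r // lt_neqAle eq_sym wi.
    exact: Cplus_simplex.
  right; rewrite mxE w0 mulr0; split=> //; apply/eqP.
  rewrite kolmogorov_eq0; last exact/Lambda_Cplus/SnL.
  have : F x 0 i == 0 by rewrite FxE w0 mulr0.
  rewrite kolmogorov_eq0 // Ex !mxE !mulf_eq0 gt_eqF //= => ->; exact: orbT.
  (* [F x] is strictly below [S_star f eps], hence below some lower graph *)
- have [n Hn] := rep_gt_below_lim Ugraph_S_lower R_lower_rep R_lower_le sw lt.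
  have Hn1 := lt_le_trans Hn (R_lower_le n sw).
  have := is_radial_rep_mem (R_lower_rep n.+1) sw.
  rewrite S_lower_succ => -[y Sy Ey].
  apply: (no_face_lt_star_lower Sx Sy).
  have [SnL _ _] := Ugraph_S_lower n.
  apply: kolmogorov_face_lt; [exact: SL|exact: SnL|].
  by rewrite -/F Fx Ey; apply: face_lt_ray => //; exact: ltW.
Qed.

Lemma S_star_invariant : F @` S_star f eps = S_star f eps.
Proof.
apply/seteqP; split=> [|_ [w sw <-]]; first exact: S_star_sub.
have rF := Ugraph_radial_rep (Ugraph_kolmogorov S_star_Ugraph).
have FSw := is_radial_rep_mem rF sw.
rewrite -/l -(is_radial_rep_val S_star_rep sw _ (S_star_sub FSw)) //.
by case: rF => _ r0 _; exact: r0.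
Qed.

(** Two ordered points of [S_star f eps] are images of points of [S_star f eps].
    Either assumption makes the order of the latter strict on the whole support
    of the larger one. *)
Lemma S_star_unordered :
  (retrotone F (Lambda kappa) \/
   forall x y, Cplus x -> Cplus y -> ltv x y -> forall i, f x 0 i > f y 0 i) ->
  unordered (S_star f eps).
Proof.
move=> H x y Sx Sy _ xy; have [SL nS _] := S_star_Ugraph.
move: Sx Sy xy; rewrite -S_star_invariant => -[p Sp <-] [q Sq <-] Fpq.
have [Lp Lq] := (SL _ Sp, SL _ Sq).
have [Cp Cq] := (Lambda_Cplus Lp, Lambda_Cplus Lq).
apply: (nS _ _ Sp Sq); split; first exact: Ugraph_neq0 S_star_Ugraph Sq.
have [leF _] := Fpq.
move=> i; have [q0|qi] := eqVneq (q 0 i) 0.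
  right; split=> //; apply/eqP; rewrite -kolmogorov_eq0 // eq_le kolmogorov_Cplus // andbT.
  by apply: le_trans (leF i) _; rewrite kolmogorovE q0 mul0r.
left; have {}qi : 0 < q 0 i by rewrite lt_neqAle eq_sym qi Cq.
case: H => [/(_ _ _ Lp Lq Fpq i qi) //|dec].
have [|pq _] := F_wretro Lp Lq Fpq (I := finset.set0).
  by move=> j; rewrite finset.in_set0.
have fpq := dec p q Cp Cq pq i.
have := leF i; rewrite !kolmogorovE => le.
rewrite -(ltr_pM2r (fitness_gt0 i Cp)); apply: le_lt_trans le _.
by rewrite ltr_pM2l.
Qed.

(** * The gauge of S_star *)

(** The homogeneous function that is 1 on [S_star f eps]. *)
Definition gauge x := norm1 x / l (radial_proj x).

Lemma gauge_ray t u : 0 < t -> simplex u -> gauge (t *: u) = t / l u.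
Proof. by move=> t0 su; rewrite /gauge norm1_ray ?(ltW t0) // radial_proj_ray. Qed.

Lemma continuous_gauge : {within [set x | Cplus x /\ x <> 0], continuous gauge}.
Proof.
rewrite continuous_subspace_in => x /[dup] xA /set_mem[Cx x0].
have sx := simplex_radial_proj Cx x0.
apply: (@continuousM _ (subspace [set x | Cplus x /\ x <> 0])).
  by move: x {xA Cx x0 sx}; apply: continuous_subspaceT; exact: continuous_norm1.
apply: (@continuousV _ (subspace [set x | Cplus x /\ x <> 0])).
  by rewrite gt_eqF // R_star_gt0.
move: x {xA Cx x0 sx}.
apply: (@within_comp _ _ _ _ simplex (@radial_proj R d) l).
- by apply: continuous_in_subspaceT => x /set_mem[_ x0]; exact: continuous_radial_proj.
- by move=> x [Cx x0]; exact: simplex_radial_proj.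
by case: S_star_rep.
Qed.

(** Divide [F q] by its gauge [rho] to get a point of [S_star f eps], and pull
    it back to a point [p] of [S_star f eps]; then [face_lt p q]. By (beta) the
    growth factors are smaller at [q] than at [p], although [F q] is [rho] times
    [F p]; so the positive coordinates of [q] exceed [rho] times those of [p]. If
    the gauge of [q] were at most [rho], the point of [S_star f eps] on the ray of
    [q] would be strictly above [p]. *)
Lemma gauge_lt q : Lambda kappa q -> q <> 0 -> 1 < gauge (F q) ->
  gauge (F q) < gauge q.
Proof.
move=> Lq q0 g1; have Cq := Lambda_Cplus Lq.
have CF := kolmogorov_Cplus Cq; have F0 := kolmogorov_neq0 Cq q0.
have sw := simplex_radial_proj CF F0; have lw := R_star_gt0 sw.
have sv := simplex_radial_proj Cq q0; have lv := R_star_gt0 sv.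
set w := radial_proj (F q) in sw lw *; set v := radial_proj q in sv lv *.
set rho := gauge (F q) in g1 *.
have Fq : F q = rho *: (l w *: w).
  by rewrite scalerA divfK ?gt_eqF // radial_projK.
have : S_star f eps (l w *: w) by exists w.
rewrite -S_star_invariant => -[p Sp Fp].
have [SL nS _] := S_star_Ugraph; have Lp := SL _ Sp; have Cp := Lambda_Cplus Lp.
have Fpq : face_lt (F p) (F q).
  rewrite Fq Fp scalerA; apply: face_lt_ray; rewrite ?(ltW lw) //.
  by rewrite ltr_pMl.
have pq := kolmogorov_face_lt Lp Lq Fpq.
have [_ dec] := beta Lp Lq (face_lt_ltv (kolmogorov_Cplus Cp) Fpq).
rewrite ltNge; apply/negP => gq.
apply: (nS p (l v *: v) Sp); first by exists v.
have q_le i : q 0 i <= rho * (l v * v 0 i).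
  rewrite -{1}(radial_projK q0) mxE mulrA; apply: ler_wpM2r.
    exact: Cplus_simplex.
  by move: gq; rewrite /gauge ler_pdivrMr.
split=> [E|i].
  apply: q0; apply/rowP => i; rewrite [RHS]mxE; apply/eqP; rewrite eq_le Cq andbT.
  by have := q_le i; have /rowP/(_ i) := E; rewrite !mxE => ->; rewrite mulr0.
rewrite mxE; have [_ /(_ i)[pqi|[p0 q0i]]] := pq; last first.
  by right; split=> //; rewrite mxE q0i !mulr0.
have [p0|pi] := eqVneq (p 0 i) 0.
  left; rewrite p0 -(pmulr_rgt0 _ (lt_trans ltr01 g1)).
  by apply: lt_le_trans (q_le i); rewrite -p0.
left; rewrite -(ltr_pM2l (lt_trans ltr01 g1)); apply: lt_le_trans (q_le i).
have {}pi : 0 < p 0 i by rewrite lt_neqAle eq_sym pi Cp.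
have Fpi : 0 < F p 0 i by rewrite kolmogorovE mulr_gt0 // fitness_gt0.
have FqE : F q 0 i = rho * F p 0 i by rewrite Fq Fp mxE.
have Flt : F p 0 i < F q 0 i by rewrite FqE ltr_pMl.
have [p0|fpq] := dec i Flt; first by rewrite p0 ltxx in pi.
rewrite -(ltr_pM2r (fitness_gt0 i Cq)) -[ltRHS]kolmogorovE FqE kolmogorovE mulrA.
by rewrite ltr_pM2l // mulr_gt0 // (lt_trans ltr01).
Qed.

(** Compactness makes the drop of [gauge_lt] uniform; the lower bound on the norm
    keeps [q] away from the origin, where no direction is defined. *)
Lemma gauge_drop (delta : R) : 0 < delta -> exists2 eta, 0 < eta &
  forall q, Lambda kappa q -> eps <= norm1 q -> 1 + delta <= gauge (F q) ->
    gauge (F q) + eta <= gauge q.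
Proof.
move=> delta0; pose K := Lambda kappa `&` [set q : 'rV[R]_d | eps <= norm1 q].
have cK : compact K.
  apply: compact_closedI; first exact: compact_Lambda.
  have /continuous_closedP/(_ [set r | eps <= r]) := @continuous_norm1 R d.
  by apply; exact: closed_ge.
have K0 q : K q -> Cplus q /\ q <> 0.
  move=> [Lq nq]; split; first exact: Lambda_Cplus Lq.
  move=> E; move: nq; rewrite /= E /norm1 big1 => [|i _]; last by rewrite mxE normr0.
  by rewrite leNgt eps_gt0.
have cg : {within K, continuous gauge}.
  by apply: continuous_subspaceW continuous_gauge => q /K0.
have cgF : {within K, continuous (gauge \o F)}.
  apply: (within_comp _ _ continuous_gauge) => [|q /K0[Cq q0]].
    by apply: continuous_subspaceW continuous_kolmogorov => q /K0[].
  by split; [exact: kolmogorov_Cplus|exact: kolmogorov_neq0].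
have : \forall N \near \oo, K `<=` [set q | 1 + delta <= gauge (F q) ->
    gauge (F q) + 1 / N%:R <= gauge q].
  apply: (near_covering_withinP _).2; first exact/compact_near_coveringP.
  move=> q Kq; have [small|big] := ltrP (gauge (F q)) (1 + delta).
    have near1 := within_near_lt cgF Kq small.
    near=> q' N => Kq'; rewrite /= leNgt => /negP; case.
    exact: (near near1 q').
  have gap : gauge (F q) < gauge q.
    have [Lq _] := Kq; have [_ q0] := K0 q Kq; apply: gauge_lt => //.
    by apply: lt_le_trans big; rewrite ltrDl.
  pose e := (gauge q - gauge (F q)) / 3.
  have e0 : 0 < e by rewrite divr_gt0 // subr_gt0.
  have near1 : \forall q' \near q, K q' -> gauge (F q') < gauge (F q) + e.
    by apply: (within_near_lt cgF Kq); rewrite /= ltrDl.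
  have near2 : \forall q' \near q, K q' -> gauge q - e < gauge q'.
    by apply: (within_near_gt cg Kq); rewrite ltrBlDr ltrDl.
  near=> q' N => Kq' _.
  have h1 : gauge (F q') < gauge (F q) + e by apply: (near near1 q').
  have h2 : gauge q - e < gauge q' by apply: (near near2 q').
  have h3 : 1 / N%:R < e by near: N; exact: near_natV_lt.
  move: h1 h2 h3; rewrite /e; lra.
move=> /(filterI (nbhs_infty_gt 0)) /filter_ex[N [N0 HN]].
exists (1 / N%:R); first by rewrite divr_gt0 // ltr0n.
by move=> q Lq nq; apply: HN.
Unshelve. all: by end_near. Qed.

(** * The upper sequence *)

Lemma Ugraph_S_upper0 : Ugraph kappa (S_upper f kappa 0).
Proof.
have k0 : 0 < 1 + kappa by rewrite addr_gt0.
rewrite /S_upper image_id; apply: compact_Ugraph.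
- have -> : [set x : 'rV[R]_d | Lambda kappa x /\ exists k, x 0 k = 1 + kappa] =
      Lambda kappa `&` \bigcup_(k in [set: 'I_d]) [set x | x 0 k = 1 + kappa].
    apply/seteqP; split=> x [Lx H]; split=> //.
      by case: H => k xk; exists k.
    by case: H => k _ xk; exists k.
  apply: compact_closedI; first exact: compact_Lambda.
  apply: closed_bigcup; first exact: finite_finset.
  by move=> k _; apply: closed_eq_level; exact: coord_continuous.
- by move=> x [].
- by move=> [_ [k /eqP]]; rewrite mxE eq_sym gt_eqF.
- move=> x y [_ [k xk]] [Ly _] [_ /(_ k)]; rewrite xk => -[|[/eqP]].
    by rewrite ltNge; have /LambdaP/(_ k)/andP[_ ->] := Ly.
  by rewrite gt_eqF.
move=> u su.
have [k0' _] := neq0_gt0 (Cplus_simplex su) (simplex_neq0 su).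
pose k := [arg max_(i > k0') u 0 i]%O.
have umax i : u 0 i <= u 0 k by rewrite /k; case: arg_maxP => // j _; apply.
have uk : 0 < u 0 k.
  have [i ui] := neq0_gt0 (Cplus_simplex su) (simplex_neq0 su).
  exact: lt_le_trans ui (umax i).
exists ((1 + kappa) / u 0 k); first exact: divr_gt0.
split; last by exists k; rewrite mxE divfK // gt_eqF.
apply/LambdaP => i; rewrite mxE mulr_ge0 ?(Cplus_simplex su) ?divr_ge0 ?(ltW k0) ?(ltW uk) //=.
by rewrite -mulrA ger_pMr // mulrC ler_pdivrMr // mul1r.
Qed.

Lemma Ugraph_S_upper n : Ugraph kappa (S_upper f kappa n).
Proof.
elim: n => [|n IH]; first exact: Ugraph_S_upper0.
by rewrite S_upper_succ; exact: Ugraph_kolmogorov.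
Qed.

Lemma R_upper_rep n : is_radial_rep (S_upper f kappa n) (R_upper f kappa n).
Proof. exact/Ugraph_radial_rep/Ugraph_S_upper. Qed.

Lemma R_star_le_upper n u : simplex u -> l u <= R_upper f kappa n u.
Proof.
elim: n u => [|n IH] u su.
  have := is_radial_rep_mem (R_upper_rep 0) su.
  rewrite {1}/S_upper image_id => -[_ [k]]; rewrite mxE => rk.
  have [SL _ _] := S_star_Ugraph.
  have /LambdaP/(_ k) := SL _ (is_radial_rep_mem S_star_rep su).
  rewrite -rk mxE => /andP[_]; rewrite ler_pM2r // lt_neqAle (Cplus_simplex su).
  rewrite andbT; apply/eqP => u0; move: rk; rewrite -u0 mulr0 => /eqP.
  by rewrite lt_eqF // addr_gt0.
have repE v : simplex v -> radial_rep (S_star f eps) v = l v.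
  move=> sv; have rS := Ugraph_radial_rep S_star_Ugraph.
  apply: (is_radial_rep_val S_star_rep sv); last exact: is_radial_rep_mem rS sv.
  by case: rS => _ r0 _; exact: r0.
rewrite -repE // -{1}S_star_invariant /R_upper S_upper_succ.
apply: radial_rep_kolmogorov_le => //; first exact: S_star_Ugraph.
  exact: Ugraph_S_upper.
by move=> v sv; rewrite repE //; exact: IH.
Qed.

Lemma R_star_le u : simplex u -> l u <= d%:R * (1 + kappa).
Proof.
move=> su; have [SL _ _] := S_star_Ugraph.
have Sl := SL _ (is_radial_rep_mem S_star_rep su).
by rewrite -(norm1_ray (ltW (R_star_gt0 su)) su) norm1_Lambda.
Qed.

Lemma gauge_S_upper (delta eta : R) n x : 0 < eta ->
  (forall q, Lambda kappa q -> eps <= norm1 q -> 1 + delta <= gauge (F q) ->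
    gauge (F q) + eta <= gauge q) ->
  S_upper f kappa n x ->
  gauge x <= Num.max (1 + delta) (d%:R * (1 + kappa) / eps - n%:R * eta).
Proof.
move=> eta0 drop; elim: n x => [|n IH] x Sx.
  have [SL _ _] := Ugraph_S_upper 0.
  have [u [su ru Ex]] := is_radial_rep_inv (R_upper_rep 0) Sx.
  have nx := norm1_Lambda (SL _ Sx).
  rewrite le_max mul0r subr0; apply/orP; right.
  rewrite Ex gauge_ray //; rewrite Ex norm1_ray ?(ltW ru) // in nx.
  apply: ler_pM => //; [exact: ltW|by rewrite invr_ge0 ltW // R_star_gt0|].
  by rewrite lef_pV2 ?posrE ?R_star_gt0 // R_star_ge.
move: Sx; rewrite S_upper_succ => -[q Sq <-].
have [small|big] := lerP (gauge (F q)) (1 + delta); first by rewrite le_max small.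
have [SL _ _] := Ugraph_S_upper n.
have [u [su ru Eq]] := is_radial_rep_inv (R_upper_rep n) Sq.
have nq : eps <= norm1 q.
  rewrite Eq norm1_ray ?(ltW ru) //.
  exact: le_trans (R_star_ge su) (R_star_le_upper n su).
have := drop q (SL _ Sq) nq (ltW big); have := IH q Sq.
rewrite !le_max => /orP[h1|h1] h2; apply/orP; [left|right]; first lra.
by rewrite -addn1 natrD mulrDl mul1r; lra.
Qed.

(** As long as it exceeds [1 + delta], the gauge of the upper graphs drops by
    [eta] at each step, so it is eventually at most [1 + delta]. *)
Lemma R_upper_uniform : {uniform simplex, R_upper f kappa n @[n --> \oo] --> l}.
Proof.
apply: uniform_cvgn => e e0.
pose B := d%:R * (1 + kappa).
have B0 : 0 <= B by rewrite mulr_ge0 // addr_ge0 // ltW.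
pose delta := e / (B + 1).
have delta0 : 0 < delta by rewrite divr_gt0 // ltr_wpDl.
have [eta eta0 drop] := gauge_drop delta0.
near=> n => u su.
have lu := R_star_gt0 su.
have ge := R_star_le_upper n su.
have Sn := is_radial_rep_mem (R_upper_rep n) su.
have := gauge_S_upper eta0 drop Sn.
rewrite gauge_ray //; last exact: lt_le_trans lu ge.
rewrite max_l; last first.
  have : B / eps / eta <= n%:R by near: n; exact: nbhs_infty_ger.
  by rewrite ler_pdivrMr // -/B; lra.
rewrite ler_pdivrMr // => le.
rewrite distrC ger0_norm ?subr_ge0 //.
apply: (@le_lt_trans _ _ (delta * l u)); first by lra.
rewrite /delta -mulrA gtr_pMr // mulrC ltr_pdivrMr ?ltr_wpDl // mul1r.
by apply: (le_lt_trans (R_star_le su)); rewrite ltrDl.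
Unshelve. all: by end_near. Qed.

End Lower.
End Dynamics.

(** Weak retrotonicity turns the inequalities between images in (beta) into
    inequalities between points, to which (alpha) applies. *)
Lemma beta_of_alpha (R : realType) (d : nat) (f : 'rV[R]_d -> 'rV[R]_d) kappa :
  weakly_retrotone (kolmogorov f) (Lambda kappa) -> condition_alpha f ->
  condition_beta kappa f.
Proof.
move=> F_wretro alpha F x y Lx Ly Fxy.
have [|xy ltI] := F_wretro [set i | F x 0 i < F y 0 i]%SET x y Lx Ly Fxy.
  by move=> i; rewrite finset.in_set.
have [ge gt] := alpha x y (Lambda_Cplus Lx) (Lambda_Cplus Ly) xy.
split=> // i Fi; right; apply/gt/ltI.
by rewrite finset.in_set.
Qed.

Theorem proposition2p27 (R : realType) (d : nat)
    (f : 'rV[R]_d -> 'rV[R]_d) (kappa eps : R)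
    (f_Cplus : forall x, Cplus x -> Cplus (f x))
    (f_cont : {within Cplus, continuous f})
    (f_pos : forall x, Cplus x -> lltv 0 (f x))
    (f_unit : forall i, f (unitv i) 0 i = 1)
    (kappa_gt0 : 0 < kappa)
    (F_homeo : local_homeo (Lambda kappa) (kolmogorov f))
    (F_wretro : weakly_retrotone (kolmogorov f) (Lambda kappa))
    (alpha_or_beta : condition_alpha f \/ condition_beta kappa f)
    (eps_gt0 : 0 < eps) (eps_lt1 : eps < 1)
    (eps_small : forall x, Cplus x -> \sum_(i < d) x 0 i <= eps ->
       forall i, 1 < f x 0 i) :
  [/\ {uniform simplex, R_lower f eps n @[n --> \oo] --> R_star f eps},
      {uniform simplex, R_upper f kappa n @[n --> \oo] --> R_star f eps},
      Uhat kappa (S_star f eps) /\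
      (retrotone (kolmogorov f) (Lambda kappa) \/
         (forall x y, Cplus x -> Cplus y -> ltv x y ->
            forall i, f x 0 i > f y 0 i) ->
       Ufam kappa (S_star f eps)) &
      kolmogorov f @` S_star f eps = S_star f eps].
Proof.
have beta : condition_beta kappa f.
  by case: alpha_or_beta => // /(beta_of_alpha F_wretro).
have star_Uhat : Uhat kappa (S_star f eps).
  by apply: Ugraph_Uhat; exact: S_star_Ugraph.
split.
- exact: (R_lower_uniform f_cont f_pos f_unit kappa_gt0 F_wretro beta).
- exact: (R_upper_uniform f_cont f_pos f_unit kappa_gt0 F_wretro beta).
- split=> // strong; split; first by case: star_Uhat.
  exact: (S_star_unordered f_cont f_pos f_unit kappa_gt0 F_wretro beta eps_gt0).
- exact: (S_star_invariant f_cont f_pos f_unit kappa_gt0 F_wretro beta).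
Qed.
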